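(* For every integer $k \geq 1$, let $\omega_k$ be the largest integer such that every error $\mathbf{e} \in \mathbb{F}_2^{E_k}$ of Hamming weight at most $\omega_k$ is decoded correctly by the renormalisation decoder on $\mathbf{T}_k$. Then $\omega_k \geq \left(\tfrac{6}{5}\right)^{k-1} - 1$. (Equivalently, since $d = 2^k$ is the minimum distance, every error of weight less than $\tfrac{5}{6} d^{\log_2(6/5)}$ is decoded correctly.)
   Context: Toric code and decoding. Fix an integer $k \geq 1$. Let $\mathbf{T}_k=(V_k,E_k)$ be the Cayley graph of $\mathbb{Z}/2^k\mathbb{Z}\times\mathbb{Z}/2^k\mathbb{Z}$ with generators $(\pm1,0),(0,\pm1)$ (a square tiling of a torus), with $n=|E_k| = 2\cdot 4^k$ edges. An error is a vector $\mathbf{e}\in\mathbb{F}_2^{E_k}$ (a set of edges); its syndrome $\sigma(\mathbf{e})$ is the set of vertices incident to an odd number of edges of $\mathbf{e}$. A decoder takes $\sigma(\mathbf{e})$ and outputs $\hat{\mathbf{e}}$ with $\sigma(\hat{\mathbf{e}})=\sigma(\mathbf{e})$; it decodes $\mathbf{e}$ correctly if $\mathbf{e}+\hat{\mathbf{e}}$ is a sum (mod 2) of faces (4-cycles $(x,y),(x+1,y),(x+1,y+1),(x,y+1)$) of $\mathbf{T}_k$, i.e. a homologically trivial cycle. The minimum distance of the code is $d=2^k$. Subtilings. For $0\le i\le k$ let $h_i=2^{k-i}$, let $V_i$ be the subgroup generated by $(h_i,0),(0,h_i)$, and let $\mathbf{T}_i$ be the graph on $V_i$ joining vertices differing by $\pm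 h_i$ in exactly one coordinate; each edge of $\mathbf{T}_i$ is identified with the corresponding straight path of length $h_i$ in $\mathbf{T}_k$, and ''flipping'' an edge of $\mathbf{T}_i$ means adding (mod 2) all edges of that path. For $i \ge 1$, a cell of $\mathbf{T}_i$ is a face of $\mathbf{T}_i$: with $h=h_i$, its vertices are $\alpha=(x,y)$ (top-left), $\beta=(x+h,y)$ (top-right), $\gamma=(x,y-h)$ (bottom-left), $\delta=(x+h,y-h)$ (bottom-right), and its edges are $t=\alpha\beta$, $b=\gamma\delta$, $l=\alpha\gamma$, $r=\beta\delta$. A block of $\mathbf{T}_i$ is a cell of $\mathbf{T}_{i-1}$, i.e. a square of side $2h$ whose top-left corner lies in $V_{i-1}$; it consists of four cells of $\mathbf{T}_i$: $A$ (top-left), $B$ (top-right), $C$ (bottom-left), $D$ (bottom-right). Reduction procedure on $\mathbf{T}_i$ (input $S\subseteq V_i$; output $\hat{\mathbf{e}}_i$, initially $0$). In each step all tests use the set $S$ as it is at the start of that step, and all blocks are treated simultaneously. Step 1: in the $D$ cell of every block, if $\alpha,\delta\in S$ flip $l$ and $b$; if $\beta,\gamma\in S$ flip $b$ and $r$ (if all four are in $S$, the net effect is to flip only $l$ and $r$); then remove all vertices so paired from $S$. Step 2: in the $C$ cell of every block, if $\alpha,\gamma\in S$ flip $l$, and if $\beta,\delta\in S$ flip $r$; in the $B$ cell of every block, if $\alpha,\beta\in S$ flip $t$, and if $\gamma,\delta\in S$ flip $b$; then remove all vertices so paired from $S$. Step 3: in the $A$ cell of every block, if $\beta\in S$ flip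 $t$; if $\gamma\in S$ flip $l$; if $\delta\in S$ flip $l$ and $b$. Renormalisation decoder. Start with $\hat{\mathbf{e}}=0$, $S=\sigma(\mathbf{e})$, $i=k$; while $S\neq\emptyset$ and $i>0$: run the reduction procedure on $\mathbf{T}_i$ with input $S$ to get $\hat{\mathbf{e}}_i$, set $\hat{\mathbf{e}}\gets\hat{\mathbf{e}}+\hat{\mathbf{e}}_i$, $S\gets S\,\triangle\,\sigma(\hat{\mathbf{e}}_i)$, $i\gets i-1$. Output $\hat{\mathbf{e}}$. *)

(* Defs.v *)
From mathcomp Require Import all_boot all_order.
From mathcomp Require Import all_algebra.
Set Implicit Arguments. Unset Strict Implicit. Unset Printing Implicit Defensive.

(* symmetric difference of finite sets (= addition mod 2 of indicator vectors) *)
Definition symd {T : finType} (A B : {set T}) : {set T} := (A :\: B) :|: (B :\: A).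
Definition opt {T : finType} (b : bool) (A : {set T}) : {set T} := if b then A else set0.

Section Toric.
Variable k : nat.

Definition N := 2 ^ k.
Lemma N_gt0 : 0 < N. Proof. by rewrite /N expn_gt0. Qed.

Definition vert := ('I_N * 'I_N)%type.
(* edges: (v, false) is the horizontal edge v -- v + (1,0);
          (v, true)  is the vertical   edge v -- v + (0,1).
   This indexes the 2 * 4^k edges of the Cayley graph (a multigraph for k = 1). *)
Definition edge := (vert * bool)%type.

Definition mkv (x y : nat) : vert :=
  (Ordinal (ltn_pmod x N_gt0), Ordinal (ltn_pmod y N_gt0)).

Definition src (ed : edge) : vert := ed.1.
Definition tgt (ed : edge) : vert :=
  if ed.2 then mkv ed.1.1 (ed.1.2).+1 else mkv (ed.1.1).+1 ed.1.2.

Definition syndrome (e : {set edge}) : {set vert} :=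
  [set v | odd #|[set ed in e | (src ed == v) || (tgt ed == v)]|].

(* the face with corners (x,y),(x+1,y),(x+1,y+1),(x,y+1) *)
Definition face (v : vert) : {set edge} :=
  [set (v, false); (mkv v.1 (v.2).+1, false); (v, true); (mkv (v.1).+1 v.2, true)].

Definition hpath (x y len : nat) : {set edge} :=
  [set (mkv (x + val j) y, false) | j : 'I_len].
Definition vpath (x y len : nat) : {set edge} :=
  [set (mkv x (y + val j), true) | j : 'I_len].

(* A cell of side h with top-left corner alpha = (x, y) (coordinates taken mod 2^k);
   y - h is computed as y + N - h (h <= N). *)
Definition c_al (h x y : nat) := mkv x y.
Definition c_be (h x y : nat) := mkv (x + h) y.
Definition c_ga (h x y : nat) := mkv x (y + N - h).
Definition c_de (h x y : nat) := mkv (x + h) (y + N - h).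
Definition c_t (h x y : nat) := hpath x y h.
Definition c_b (h x y : nat) := hpath x (y + N - h) h.
Definition c_l (h x y : nat) := vpath x (y + N - h) h.
Definition c_r (h x y : nat) := vpath (x + h) (y + N - h) h.

(* Block of T_i with top-left corner (X, Y) in V_{i-1}, cells of side h = h_i:
   A has top-left (X, Y), B has (X+h, Y), C has (X, Y-h), D has (X+h, Y-h). *)
Section Steps.
Variables (h : nat) (S : {set vert}) (X Y : nat).

Definition s1_p1 := (c_al h (X + h) (Y + N - h) \in S) && (c_de h (X + h) (Y + N - h) \in S).
Definition s1_p2 := (c_be h (X + h) (Y + N - h) \in S) && (c_ga h (X + h) (Y + N - h) \in S).
Definition step1_flip : {set edge} :=
  symd (opt s1_p1 (symd (c_l h (X + h) (Y + N - h)) (c_b h (X + h) (Y + N - h))))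
       (opt s1_p2 (symd (c_b h (X + h) (Y + N - h)) (c_r h (X + h) (Y + N - h)))).
Definition step1_rem : {set vert} :=
  opt s1_p1 [set c_al h (X + h) (Y + N - h); c_de h (X + h) (Y + N - h)]
  :|: opt s1_p2 [set c_be h (X + h) (Y + N - h); c_ga h (X + h) (Y + N - h)].

Definition s2_C1 := (c_al h X (Y + N - h) \in S) && (c_ga h X (Y + N - h) \in S).
Definition s2_C2 := (c_be h X (Y + N - h) \in S) && (c_de h X (Y + N - h) \in S).
Definition s2_B1 := (c_al h (X + h) Y \in S) && (c_be h (X + h) Y \in S).
Definition s2_B2 := (c_ga h (X + h) Y \in S) && (c_de h (X + h) Y \in S).
Definition step2_flip : {set edge} :=
  symd (symd (opt s2_C1 (c_l h X (Y + N - h))) (opt s2_C2 (c_r h X (Y + N - h))))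
       (symd (opt s2_B1 (c_t h (X + h) Y)) (opt s2_B2 (c_b h (X + h) Y))).
Definition step2_rem : {set vert} :=
  opt s2_C1 [set c_al h X (Y + N - h); c_ga h X (Y + N - h)]
  :|: opt s2_C2 [set c_be h X (Y + N - h); c_de h X (Y + N - h)]
  :|: opt s2_B1 [set c_al h (X + h) Y; c_be h (X + h) Y]
  :|: opt s2_B2 [set c_ga h (X + h) Y; c_de h (X + h) Y].

Definition step3_flip : {set edge} :=
  symd (symd (opt (c_be h X Y \in S) (c_t h X Y))
             (opt (c_ga h X Y \in S) (c_l h X Y)))
       (opt (c_de h X Y \in S) (symd (c_l h X Y) (c_b h X Y))).
End Steps.

(* block corners of T_i = vertices of V_{i-1}, i.e. multiples of 2 h_i *)
Definition corners (h : nat) : {set vert} :=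
  [set v : vert | ((2 * h) %| v.1) && ((2 * h) %| v.2)].

Definition reduction (i : nat) (S : {set vert}) : {set edge} :=
  let h := 2 ^ (k - i) in
  let F1 := \big[symd/set0]_(v in corners h) step1_flip h S v.1 v.2 in
  let S1 := S :\: \bigcup_(v in corners h) step1_rem h S v.1 v.2 in
  let F2 := \big[symd/set0]_(v in corners h) step2_flip h S1 v.1 v.2 in
  let S2 := S1 :\: \bigcup_(v in corners h) step2_rem h S1 v.1 v.2 in
  let F3 := \big[symd/set0]_(v in corners h) step3_flip h S2 v.1 v.2 in
  symd F1 (symd F2 F3).

Fixpoint dec_loop (i : nat) (S : {set vert}) : {set edge} :=
  match i with
  | 0 => set0
  | i'.+1 =>
      if S == set0 then set0
      else let ei := reduction i S in
           symd ei (dec_loop i' (symd S (syndrome ei)))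
  end.

Definition decoder (e : {set edge}) : {set edge} := dec_loop k (syndrome e).

Definition decoded_correctly (e : {set edge}) : Prop :=
  exists F : {set vert}, symd e (decoder e) = \big[symd/set0]_(f in F) face f.

Definition decodes_upto (w : nat) : Prop :=
  forall e : {set edge}, #|e| <= w -> decoded_correctly e.

End Toric.

(* Main.v *)
Require Import Defs.
From mathcomp Require Import all_boot all_order all_algebra.
From mathcomp Require Import zify.

(** An edge set is written, up to faces, as a sum of pieces: pairs [(p, q)] of
    points of the universal cover, standing for a path from [p] to [q], of weight
    [1 + |p - q|_1].  One level of the decoder partitions the vertices in two
    ways, into A cells and into D cells.  Steps 1 and 2 pair up the syndrome
    inside each D cell until at most one vertex is left there, and step 3 contracts
    each A cell to its corner.  Pieces whose ends are paired get concatenated into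
    walks, and a walk from [p] to [q] becomes the single piece (A cell of [p],
    A cell of [q]) of the next level.  In a walk each coordinate of the displacement
    is halved up to rounding, and rounding costs so little that the total weight
    shrinks by a factor 5/6.  An error of weight less than [(6/5)^(k-1)] starts
    with total weight less than [2 (6/5)^(k-1)]; at level 1 less than 2 remains,
    which leaves no piece at all. *)

Set Implicit Arguments.
Unset Strict Implicit.
Unset Printing Implicit Defensive.

Import GRing.Theory Num.Theory.

(** * Weights of pieces and walks *)

Definition point := (nat * nat)%type.

Definition dist (a b : nat) : nat := (a - b) + (b - a).
Definition dist1 (p q : point) : nat := dist p.1 q.1 + dist p.2 q.2.

(* The y axis points up, so that the A cell with corner [(2a, 2b)] is
   [{2a, 2a+1} x {2b-1, 2b}] and the D cells are [{2a-1, 2a} x {2b, 2b+1}]. *)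
Definition cellA (p : point) : point := (p.1./2, uphalf p.2).
Definition cellD (p : point) : point := (uphalf p.1, p.2./2).

(* Twice the l1 distance from the centre of the A cell of [p] to the centre of the
   D cell of [q], in units of a cell of the next level. *)
Definition distAD (p q : point) : nat :=
  dist (2 * (cellA p).1 + 1) (2 * (cellD q).1)
  + dist (2 * (cellA p).2) (2 * (cellD q).2 + 1).

Definition single (p q : point) (W : nat) : Prop := 1 + dist1 p q <= W.

Definition composite (p q : point) (W : nat) : Prop :=
  6 * (1 + dist1 (cellA p) (cellA q)) <= 5 * W /\
  6 * (1 + dist1 (cellD p) (cellD q)) <= 5 * W.

(* Invariant of a walk from [p] to [q] made of pieces of total weight [W].  A walk of
   several pieces ([composite]) satisfies the bounds wanted at the next level; a
   single piece does so only if its ends do not lie in the same D cell. *)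
Definition good (p q : point) (W : nat) : Prop :=
  [/\ 3 * distAD p q + 3 <= 5 * W, 3 * distAD q p + 3 <= 5 * W,
      6 * dist1 (cellD p) (cellD q) + 3 <= 5 * W
    & single p q W \/ composite p q W].

(** In each coordinate the centres compared by [distAD] are an odd distance apart, at most one more
    than the displacement. So [distAD p q <= dist1 p q + 2], which suffices once [dist1 p q >= 2],
    and a unit step has [distAD p q = 2]. For [p = q] the bounds fail at weight 1. *)
Lemma good_single p q W : p != q -> single p q W -> good p q W.
Proof.
case: p q => [x y] [x' y']; rewrite xpair_eqE negb_and => npq s.
have {}npq : x <> x' \/ y <> y' by case/orP: npq => /eqP; [left|right].
by split; last (by left); move: s npq;
  rewrite /single /distAD /dist1 /cellA /cellD /dist /=; lia.
Qed.

Lemma good_sym p q W : good p q W -> good q p W.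
Proof.
have dC a b : dist a b = dist b a by rewrite /dist addnC.
have d1C a b : dist1 a b = dist1 b a by rewrite /dist1 dC (dC a.2).
case=> h1 h2 h3 h4; split=> //; first by rewrite d1C.
by case: h4 => [s|[cA cD]]; [left; rewrite /single d1C | right; split; rewrite d1C].
Qed.

(* Triangle inequality through the centre of the common D cell. *)
Lemma good_cat p q p' q' W W' :
  cellD q = cellD p' -> good p q W -> good p' q' W' -> good p q' (W + W').
Proof.
move=> e [h1 h2 h3 _] [h1' h2' h3' _].
have tri a b c : dist a c <= dist a b + dist b c by rewrite /dist; lia.
have dC a b : dist a b = dist b a by rewrite /dist addnC.
have d2 a b : dist (2 * a + 1) (2 * b + 1) = 2 * dist a b by rewrite /dist; lia.
have d2' a b : dist (2 * a) (2 * b) = 2 * dist a b by rewrite /dist; lia.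
move: h1 h2 h3 h1' h2' h3'; rewrite /good /composite /distAD /dist1 -e.
rewrite !(dC (2 * (cellA q').1 + 1)) !(dC (2 * (cellA q').2)).
move: (cellA p) (cellD p) (cellA q') (cellD q') (cellD q) (cellA q) (cellA p').
move=> a d a' d' c b b' h1 h2 h3 h1' h2' h3'.
have := tri (2 * a.1 + 1) (2 * c.1) (2 * d'.1).
have := tri (2 * a.2) (2 * c.2 + 1) (2 * d'.2 + 1).
have := tri (2 * d.1) (2 * c.1) (2 * a'.1 + 1).
have := tri (2 * d.2 + 1) (2 * c.2 + 1) (2 * a'.2).
have := tri (2 * a.1 + 1) (2 * c.1) (2 * a'.1 + 1).
have := tri (2 * a.2) (2 * c.2 + 1) (2 * a'.2).
have := tri d.1 c.1 d'.1; have := tri d.2 c.2 d'.2.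
(* The two slacks of 3 add up to the 6 required by [composite]. *)
rewrite !d2 !d2'; split; [| | | right; split]; lia.
Qed.

(** A unit step in one coordinate crosses a border of A cells or one of D cells, never both. Single
    pieces between distinct A cells that could violate the bound are unit steps and diagonal unit
    steps across A borders only, and these stay inside one D cell. *)
Lemma good_open p q W : good p q W -> cellD p != cellD q -> cellA p != cellA q ->
  6 * (1 + dist1 (cellA p) (cellA q)) <= 5 * W.
Proof.
case=> _ _ _ [s|[c _] //].
case: p q s => [x y] [x' y']; rewrite /single /dist1 /cellA /cellD /dist /=.
rewrite !xpair_eqE !negb_and => s nD nA.
have {}nD : uphalf x <> uphalf x' \/ y./2 <> y'./2.
  by case/orP: nD => /eqP; [left|right].
have {}nA : x./2 <> x'./2 \/ uphalf y <> uphalf y'.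
  by case/orP: nA => /eqP; [left|right].
lia.
Qed.

(* A closed walk winds around the torus, by [2 a - 2 b] cells of the next level. *)
Lemma good_closed p q W (a b : point) : good p q W -> a <> b ->
  (cellD q).1 + 2 * a.1 = (cellD p).1 + 2 * b.1 ->
  (cellD q).2 + 2 * a.2 = (cellD p).2 + 2 * b.2 ->
  6 * (1 + dist1 (2 * a.1, 2 * a.2) (2 * b.1, 2 * b.2)) <= 5 * W.
Proof.
case: a b => [a1 a2] [b1 b2] [_ _ _ g] nab e1 e2.
have {}nab : a1 <> b1 \/ a2 <> b2.
  by case: (a1 =P b1) nab => [->|]; [move=> n; right => e; rewrite e in n|left].
case: p q e1 e2 g => [x y] [x' y'].
rewrite /single /composite /dist1 /cellA /cellD /dist /= => e1 e2 [s|[_ c]]; lia.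
Qed.

(** * Homology classes *)

Lemma in_symd (T : finType) (A B : {set T}) x :
  (x \in symd A B) = (x \in A) (+) (x \in B).
Proof. by rewrite !inE; case: (x \in A); case: (x \in B). Qed.

Lemma symd0 (T : finType) (A : {set T}) : symd A set0 = A.
Proof. by apply/setP => x; rewrite in_symd inE addbF. Qed.

Lemma symdA (T : finType) : associative (@symd T).
Proof. by move=> A B C; apply/setP => x; rewrite !in_symd addbA. Qed.

Ltac char2 :=
  apply/rowP => ?; rewrite !mxE;
  repeat match goal with |- context [fun_of_matrix ?M ?i ?j] =>
    case: (fun_of_matrix M i j) end.

Section Homology.
Variable k : nat.
Local Notation N := (Defs.N k).
Local Notation vert := (Defs.vert k).
Local Notation edge := (Defs.edge k).
Local Notation mkv := (Defs.mkv k).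
Local Open Scope ring_scope.

(** [bool] serves as the two-element field, which makes [cokermx] and [submxP] available. *)
Definition vec (A : {set edge}) : 'rV[bool]_#|{: edge}| :=
  \row_j (enum_val j \in A).

Lemma vecD A B : vec (symd A B) = vec A + vec B.
Proof. by apply/rowP => j; rewrite !mxE in_symd. Qed.

Lemma vec_inj : injective vec.
Proof.
move=> A B /rowP eAB; apply/setP => x.
by have := eAB (enum_rank x); rewrite !mxE enum_rankK.
Qed.

Lemma vec0 : vec set0 = 0.
Proof. by apply/rowP => j; rewrite !mxE inE. Qed.

Lemma vec_sum (I : Type) (r : seq I) (P : pred I) (F : I -> {set edge}) :
  vec (\big[@symd _/set0]_(i <- r | P i) F i) = \sum_(i <- r | P i) vec (F i).
Proof. exact: (big_morph vec vecD vec0). Qed.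

Definition face_mx : 'M[bool]_(#|{: vert}|, #|{: edge}|) :=
  \matrix_i vec (face (enum_val i)).

(* [cl A = 0] iff [A] is a sum of faces, so [cl A] is the class of [A] modulo faces. *)
Definition cl (A : {set edge}) : 'rV[bool]_#|{: edge}| := vec A *m cokermx face_mx.

Lemma clD A B : cl (symd A B) = cl A + cl B.
Proof. by rewrite /cl vecD mulmxDl. Qed.

Lemma cl0 : cl set0 = 0.
Proof. by rewrite /cl vec0 mul0mx. Qed.

Lemma cl_sum (I : Type) (r : seq I) (P : pred I) (F : I -> {set edge}) :
  cl (\big[@symd _/set0]_(i <- r | P i) F i) = \sum_(i <- r | P i) cl (F i).
Proof. exact: (big_morph cl clD cl0). Qed.

Lemma cl_opt b A : cl (opt b A) = if b then cl A else 0.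
Proof. by case: b => //=; rewrite cl0. Qed.

Lemma cl_eq0 A : cl A = 0 ->
  exists F : {set vert}, A = \big[@symd _/set0]_(f in F) face f.
Proof.
move=> A0.
have /submxP[u eA] : (vec A <= face_mx)%MS by rewrite submxE; apply/eqP.
exists [set f | u 0 (enum_rank f)]; apply: vec_inj; rewrite vec_sum eA.
rewrite mulmx_sum_row (reindex _ (onW_bij _ (@enum_rank_bij vert))) /=.
rewrite [RHS]big_mkcond; apply: eq_bigr => f _; rewrite inE rowK enum_rankK.
by case: (u _ _); rewrite ?scale1r ?scale0r.
Qed.

Lemma cl_face f : cl (face f) = 0.
Proof.
apply/eqP; rewrite -submxE.
apply/submxP; exists (delta_mx 0 (enum_rank f)).
by rewrite -rowE rowK enum_rankK.
Qed.

Lemma oppb2 n (x : 'rV[bool]_n) : - x = x.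
Proof. by apply/rowP => j; rewrite !mxE. Qed.

Lemma addb2 n (x : 'rV[bool]_n) : x + x = 0.
Proof. by rewrite -{2}(oppb2 x) subrr. Qed.

End Homology.

(** * Potentials on the universal cover *)

Section Potential.
Variable k : nat.
Hypothesis k_gt0 : 0 < k.
Local Notation N := (Defs.N k).
Local Notation vert := (Defs.vert k).
Local Notation edge := (Defs.edge k).
Local Notation mkv := (Defs.mkv k).

Lemma N_gt1 : 1 < N.
Proof. by rewrite /Defs.N -{1}(expn0 2) ltn_exp2l. Qed.

Lemma mkv_eq a b c d : (mkv a b == mkv c d) = (a == c %[mod N]) && (b == d %[mod N]).
Proof. by rewrite xpair_eqE. Qed.

Lemma mkvP a b c d : a = c %[mod N] -> b = d %[mod N] -> mkv a b = mkv c d.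
Proof. by move=> e1 e2; apply/eqP; rewrite mkv_eq e1 e2 !eqxx. Qed.

Lemma mkv_val (v : vert) : mkv v.1 v.2 = v.
Proof.
case: v => a b; congr (_, _); apply: val_inj => /=; exact: modn_small.
Qed.

Lemma mkv_shift x y a b : mkv (x + N * a) (y + N * b) = mkv x y.
Proof. by apply: mkvP; rewrite -modnDmr modnMr addn0. Qed.

Lemma faceE x y : face (mkv x y) =
  symd (symd [set (mkv x y, false)] [set (mkv x y.+1, false)])
       (symd [set (mkv x y, true)] [set (mkv x.+1 y, true)]).
Proof.
have neqS a : (a == a.+1 %[mod N]) = false.
  apply/negbTE; rewrite -{1}(addn0 a) -addn1 eqn_modDl mod0n modn_small //.
  exact: N_gt1.
have e1 : mkv (mkv x y).1 ((mkv x y).2).+1 = mkv x y.+1.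
  by apply: mkvP; rewrite /= ?modn_mod // -addn1 modnDml addn1.
have e2 : mkv ((mkv x y).1).+1 (mkv x y).2 = mkv x.+1 y.
  by apply: mkvP; rewrite /= ?modn_mod // -addn1 modnDml addn1.
have n1 : (mkv x y == mkv x y.+1) = false by rewrite mkv_eq neqS andbF.
have n2 : (mkv x y == mkv x.+1 y) = false by rewrite mkv_eq neqS.
rewrite /face e1 e2; apply/setP => -[v b]; rewrite !in_symd !inE !xpair_eqE.
case: (v =P mkv x y) => [->|_]; first by rewrite n1 n2; case: b.
by case: b; case: (v == _); case: (v == _).
Qed.

(* [run x y] goes from the origin to [(x, 0)] and then to [(x, y)] in the universal
   cover; an edge that is run through twice cancels. *)
Fixpoint hrun (x : nat) : {set edge} :=
  if x is x'.+1 then symd (hrun x') [set (mkv x' 0, false)] else set0.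

Fixpoint run (x y : nat) : {set edge} :=
  if y is y'.+1 then symd (run x y') [set (mkv x y', true)] else hrun x.

Local Open Scope ring_scope.

(** Class of a path from the origin to [(x, y)]. Coordinates are not reduced modulo [N], so [pot]
    records the winding around the torus. *)
Definition pot (x y : nat) : 'rV[bool]_#|{: edge}| := cl (run x y).

Lemma pot_vedge x y : cl [set (mkv x y, true)] = pot x y.+1 - pot x y.
Proof. by rewrite /pot /= clD addrC addKr. Qed.

(** Induction on the height: a face carries the edge from height [y] to [y.+1]. With [pot_vedge],
    the class of any path is the difference of [pot] at its ends. *)
Lemma pot_hedge x y : cl [set (mkv x y, false)] = pot x.+1 y - pot x y.
Proof.
elim: y => [|y IHy]; first by rewrite /pot /= clD addrC addKr.
have := cl_face (mkv x y); rewrite faceE !clD IHy !pot_vedge.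
rewrite [_ + cl _]addrC -addrA => /eqP; rewrite addr_eq0 oppb2 => /eqP ->.
by move: (pot x y) (pot x y.+1) (pot x.+1 y) (pot x.+1 y.+1) => *; char2.
Qed.

(** The increments of [pot] are classes of edges of the torus, hence periodic; so a period changes
    [pot] by an amount independent of the point. *)
Lemma pot_shift x y a b : pot (x + N * a) (y + N * b) = pot x y + pot (N * a) (N * b).
Proof.
elim: y => [|y IHy]; last first.
  have := pot_vedge (x + N * a) (y + N * b); rewrite mkv_shift pot_vedge.
  by move/eqP; rewrite eq_sym subr_eq -addSn IHy => /eqP ->; rewrite addrA subrK.
elim: x => [|x IHx]; first by rewrite {2}/pot /= cl0 add0r.
have := pot_hedge (x + N * a) (0 + N * b); rewrite mkv_shift pot_hedge.
by move/eqP; rewrite eq_sym subr_eq -addSn IHx => /eqP ->; rewrite addrA subrK.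
Qed.

(** A path no longer than [N] repeats no edge, so the set is the sum of its edges and the
    differences of [pot] telescope. *)
Lemma cl_hpath x y len : (len <= N)%N ->
  cl (hpath k x y len) = pot (x + len) y - pot x y.
Proof.
elim: len => [_|len IH lt_len_N].
  rewrite addn0 subrr -(cl0 k); congr cl; apply/setP => ed; rewrite inE.
  by apply/negP => /imsetP[[]].
have -> : hpath k x y len.+1 = symd (hpath k x y len) [set (mkv (x + len) y, false)].
  apply/setP => ed; rewrite in_symd inE.
  case: eqP => [->|ned].
    rewrite [_ \in hpath k x y len](_ : _ = false); last first.
      apply/negP => /imsetP[j _ []].
      move=> /eqP; rewrite eqn_modDl (modn_small lt_len_N) (modn_small (ltn_trans (ltn_ord j) lt_len_N)) => /eqP e.
      by have := ltn_ord j; rewrite -e ltnn.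
    by apply/imsetP; exists ord_max.
  rewrite addbF; apply/imsetP/imsetP => -[j _ ej].
    have ltj : (j < len)%N.
      by rewrite ltn_neqAle -ltnS ltn_ord andbT; apply/eqP => ejl; case: ned; rewrite ej [val j]ejl.
    by exists (Ordinal ltj).
  by exists (widen_ord (leqnSn _) j).
rewrite clD IH ?(ltnW lt_len_N) // pot_hedge addnS; set a := pot _ _; set b := pot _ _.
by rewrite addrC addrA subrK.
Qed.

Lemma cl_vpath x y len : (len <= N)%N ->
  cl (vpath k x y len) = pot x (y + len) - pot x y.
Proof.
elim: len => [_|len IH lt_len_N].
  rewrite addn0 subrr -(cl0 k); congr cl; apply/setP => ed; rewrite inE.
  by apply/negP => /imsetP[[]].
have -> : vpath k x y len.+1 = symd (vpath k x y len) [set (mkv x (y + len), true)].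
  apply/setP => ed; rewrite in_symd inE.
  case: eqP => [->|ned].
    rewrite [_ \in vpath k x y len](_ : _ = false); last first.
      apply/negP => /imsetP[j _ []].
      move=> /eqP; rewrite eqn_modDl (modn_small lt_len_N) (modn_small (ltn_trans (ltn_ord j) lt_len_N)) => /eqP e.
      by have := ltn_ord j; rewrite -e ltnn.
    by apply/imsetP; exists ord_max.
  rewrite addbF; apply/imsetP/imsetP => -[j _ ej].
    have ltj : (j < len)%N.
      by rewrite ltn_neqAle -ltnS ltn_ord andbT; apply/eqP => ejl; case: ned; rewrite ej [val j]ejl.
    by exists (Ordinal ltj).
  by exists (widen_ord (leqnSn _) j).
rewrite clD IH ?(ltnW lt_len_N) // pot_vedge addnS.
by rewrite addrC addrA subrK.
Qed.

(** * Syndromes *)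

Lemma in_syndromeD (A B : {set edge}) v :
  (v \in syndrome (symd A B)) = (v \in syndrome A) (+) (v \in syndrome B).
Proof.
rewrite !inE; pose P (ed : edge) := (src ed == v) || (tgt ed == v).
have cardE C : #|[set ed in C | P ed]| = (\sum_(ed | P ed) (ed \in C))%N.
  rewrite -sum1_card big_mkcond [RHS]big_mkcond /=.
  by apply: eq_bigr => ed _; rewrite inE andbC; case: (P ed) => //=; case: (_ \in _).
rewrite !cardE -oddD -big_split /=.
elim/big_rec2: _ => // ed a b _ IH; rewrite !oddD IH in_symd.
by case: (ed \in A); case: (ed \in B); rewrite /= ?addbF ?addTb ?negbK.
Qed.

Lemma syndromeD (A B : {set edge}) : syndrome (symd A B) = symd (syndrome A) (syndrome B).
Proof. by apply/setP => v; rewrite in_symd in_syndromeD. Qed.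

Lemma syndrome0 : syndrome (set0 : {set edge}) = set0.
Proof. 
apply/setP => v; rewrite !inE (_ : [set _ in _ | _] = set0) ?cards0 //.
by apply/setP => ed; rewrite !inE.
Qed.

Lemma syndrome1 (ed : edge) v : src ed != tgt ed ->
  (v \in syndrome [set ed]) = (v == src ed) (+) (v == tgt ed).
Proof.
move=> nst; rewrite inE.
have -> : [set ed0 in [set ed] | (src ed0 == v) || (tgt ed0 == v)]
   = opt ((v == src ed) || (v == tgt ed)) [set ed].
  apply/setP => ed0; rewrite !inE; case: (ed0 =P ed) => [->|/eqP/negbTE n]; rewrite /opt.
    by rewrite !(eq_sym v); case: ifP; rewrite !inE ?eqxx.
  by case: ifP; rewrite !inE ?n.
case: (v =P src ed) => [->|_]; first by rewrite (negbTE nst) /= cards1.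
by case: (v == _); rewrite /= ?cards1 ?cards0.
Qed.
 
Lemma syndrome_hedge x y v : (v \in syndrome [set (mkv x y, false)]) =
  (v == mkv x y) (+) (v == mkv x.+1 y).
Proof.
have e : tgt (mkv x y, false) = mkv x.+1 y.
  by apply: mkvP; rewrite /= ?modn_mod // -addn1 modnDml addn1.
rewrite syndrome1 ?e // mkv_eq -{1}(addn0 x) -addn1 eqn_modDl mod0n modn_small ?N_gt1 //.
Qed.

Lemma syndrome_vedge x y v : (v \in syndrome [set (mkv x y, true)]) =
  (v == mkv x y) (+) (v == mkv x y.+1).
Proof.
have e : tgt (mkv x y, true) = mkv x y.+1.
  by apply: mkvP; rewrite /= ?modn_mod // -addn1 modnDml addn1.
rewrite syndrome1 ?e // mkv_eq -{1}(addn0 y) -addn1 eqn_modDl mod0n.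
by rewrite (modn_small N_gt1) andbF.
Qed.

Lemma syndrome_face (f : vert) : syndrome (face f) = set0.
Proof.
rewrite -(mkv_val f) faceE; apply/setP => v.
rewrite !in_syndromeD !syndrome_hedge !syndrome_vedge inE.
by do 4!case: (v == _).
Qed.

(** Sets of one class differ by faces, which have empty syndrome. So a syndrome can be computed from
    any representative of the class. *)
Lemma syndrome_cl (A B : {set edge}) : cl A = cl B -> syndrome A = syndrome B.
Proof.
move=> eAB; have /cl_eq0[F eF] : cl (symd A B) = 0 by rewrite clD eAB addb2.
have : syndrome (symd A B) = set0.
  rewrite eF; elim/big_ind: _ => [|C D sC sD|f _]; first exact: syndrome0.
    by rewrite syndromeD sC sD symd0.
  exact: syndrome_face.
move=> /setP s0; apply/setP => v; have := s0 v.
by rewrite in_syndromeD in_set0; case: (v \in _); case: (v \in _).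
Qed.

Lemma syndrome_run x y v :
  (v \in syndrome (run x y)) = (v == mkv 0 0) (+) (v == mkv x y).
Proof.
elim: y => [|y IHy] /=; last first.
  by rewrite in_syndromeD IHy syndrome_vedge; do 3!case: (v == _).
elim: x => [|x IHx] /=; first by rewrite syndrome0 inE addbb.
by rewrite in_syndromeD IHx syndrome_hedge; do 3!case: (v == _).
Qed.

End Potential.

(** * Merging walks *)

Definition piece := (point * point)%type.
Definition walk := (piece * nat)%type.

Definition phi (L : seq piece) : nat := \sum_(w <- L) (1 + dist1 w.1 w.2).
Definition weight (ws : seq walk) : nat := \sum_(w <- ws) w.2.
Definition good_walk (w : walk) : Prop := good w.1.1 w.1.2 w.2.
Definition proper_pieces (L : seq piece) : bool := all (fun w => w.1 != w.2) L.

Section Walks.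
Variable k : nat.
Local Notation N := (Defs.N k).
Local Notation vert := (Defs.vert k).
Local Notation edge := (Defs.edge k).
Local Notation mkv := (Defs.mkv k).
Local Open Scope ring_scope.

(** [vtx h p] is the vertex of the torus under the point [p] of the grid of mesh [h]; [ptl h p] is
    the potential of [p] itself and still sees the sheet of the cover. *)
Definition vtx (h : nat) (p : point) : vert := mkv (h * p.1)%N (h * p.2)%N.
Definition ptl (h : nat) (p : point) := pot k (h * p.1)%N (h * p.2)%N.

Definition ends (h : nat) (L : seq piece) : seq vert :=
  flatten [seq [:: vtx h w.1; vtx h w.2] | w <- L].
Definition chain (h : nat) (L : seq piece) :=
  \sum_(w <- L) (ptl h w.2 - ptl h w.1).

(** A side of the torus has [4 * c] vertices of the current level and [2 * c] of the next one. *)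
Variables h c : nat.
Hypothesis hc : (h * (2 * (2 * c)) = N)%N.

(** [shift] translates by [u] periods of the torus; [lat u] is that translation in the coordinates
    of the next level. *)
Definition shift (p u : point) : point :=
  (p.1 + 2 * (2 * c) * u.1, p.2 + 2 * (2 * c) * u.2)%N.
Definition lat (u : point) : point := (2 * c * u.1, 2 * c * u.2)%N.

Lemma h_gt0 : (0 < h)%N.
Proof. by case: h hc (N_gt0 k) => // <-. Qed.

Lemma vtx_shift p u : vtx h (shift p u) = vtx h p.
Proof. by rewrite /vtx /shift /= !mulnDr !(mulnA h (2 * (2 * c))%N) hc mkv_shift. Qed.

Lemma cellD_shift p u : cellD (shift p u) =
  ((cellD p).1 + 2 * c * u.1, (cellD p).2 + 2 * c * u.2)%N.
Proof. by rewrite /cellD /shift /=; congr (_, _); lia. Qed.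

Lemma cellA_shift p u : cellA (shift p u) =
  ((cellA p).1 + 2 * c * u.1, (cellA p).2 + 2 * c * u.2)%N.
Proof. by rewrite /cellA /shift /=; congr (_, _); lia. Qed.

Lemma dist1_shift (p q : point) a b :
  dist1 (p.1 + a, p.2 + b)%N (q.1 + a, q.2 + b)%N = dist1 p q.
Proof. by rewrite /dist1 /dist /=; lia. Qed.

Lemma good_shift p q u W : good p q W -> good (shift p u) (shift q u) W.
Proof.
have eAD p' q' : distAD (shift p' u) (shift q' u) = distAD p' q'.
  rewrite /distAD !cellD_shift !cellA_shift /dist /=.
  by move: (cellA p') (cellD q') (2 * c * _)%N (2 * c * _)%N => *; lia.
have eD : dist1 (cellD (shift p u)) (cellD (shift q u)) = dist1 (cellD p) (cellD q).
  by rewrite !cellD_shift dist1_shift.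
have eA : dist1 (cellA (shift p u)) (cellA (shift q u)) = dist1 (cellA p) (cellA q).
  by rewrite !cellA_shift dist1_shift.
by rewrite /good /single /composite !eAD eD eA dist1_shift.
Qed.

Lemma vtx_eq p q : vtx h p = vtx h q -> exists u v, shift p u = shift q v.
Proof.
have modE a b : (h * a = h * b %[mod N])%N ->
    exists u v, (a + 2 * (2 * c) * u = b + 2 * (2 * c) * v)%N.
  rewrite -hc -!muln_modr => /eqP; rewrite eqn_pmul2l ?h_gt0 // => /eqP e.
  (* Each number is shifted by the quotient of the other, since coordinates cannot be lowered in
     [nat]. *)
  exists (b %/ (2 * (2 * c)))%N, (a %/ (2 * (2 * c)))%N.
  rewrite {1}(divn_eq a (2 * (2 * c))) {2}(divn_eq b (2 * (2 * c))) e; lia.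
move/eqP; rewrite mkv_eq => /andP[/eqP/modE[u1 [v1 e1]] /eqP/modE[u2 [v2 e2]]].
by exists (u1, u2), (v1, v2); congr (_, _).
Qed.

(* [F] is the class of a path from [a] to [b] inside a D cell. *)
Definition pass (a b : vert) (F : 'rV[bool]_#|{: edge}|) : Prop :=
  exists p q, [/\ vtx h p = a, vtx h q = b, cellD p = cellD q
                & F = ptl h q - ptl h p].

(* The class [X] is carried by walks whose ends are exactly [r] and by pieces [L] of
   the next level, coming from walks that have closed up. *)
Definition state (r : seq vert) (X : 'rV[bool]_#|{: edge}|) (B : nat) : Prop :=
  exists ws L,
    [/\ forall w, w \in ws -> good_walk w,
        perm_eq (ends h [seq w.1 | w <- ws]) r, proper_pieces L,
        chain h [seq w.1 | w <- ws] + chain (2 * h) L = X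
      & (6 * phi L + 5 * weight ws <= B)%N].

Lemma state_perm r r' X B : perm_eq r r' -> state r X B -> state r' X B.
Proof.
move=> prr' [ws [L [g p pr e b]]]; exists ws, L; split=> //; exact: perm_trans prr'.
Qed.

Lemma pick_end ws a : (forall w, w \in ws -> good_walk w) ->
  a \in ends h [seq w.1 | w <- ws] ->
  exists p q W ws',
    [/\ forall w, w \in ((p, q), W) :: ws' -> good_walk w,
        vtx h q = a,
        perm_eq (ends h [seq w.1 | w <- ws])
                (a :: vtx h p :: ends h [seq w.1 | w <- ws']),
        chain h [seq w.1 | w <- ws] =
          (ptl h q - ptl h p) + chain h [seq w.1 | w <- ws']
      & weight ws = (W + weight ws')%N].
Proof.
elim: ws => [//|[[p q] W] ws IH] g /=.
rewrite /ends /= -/(ends h _) !inE /chain /weight !big_cons /= -/(chain _ _) -/(weight _).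
have gw : good p q W by apply: (g ((p, q), W)); rewrite inE eqxx.
have gws w : w \in ws -> good_walk w by move=> ws_w; apply: g; rewrite inE ws_w orbT.
case: eqP => [-> _|_].
  exists q, p, W, ws; split=> //.
    by move=> w; rewrite inE => /orP[/eqP ->|/gws//]; apply: good_sym.
  by rewrite -[ptl h q - _]oppb2 opprB.
case: eqP => [-> _|_ /= /IH[//|p' [q' [W' [ws' [g' eq' pe e ew]]]]]].
  exists p, q, W, ws; split=> //.
  by rewrite -[_ :: _ :: _]/([:: _] ++ [:: _] ++ _) perm_catCA.
exists p', q', W', (((p, q), W) :: ws'); split=> //.
- move=> w; rewrite !inE => /or3P[/eqP ->|/eqP -> //|w_ws'].
    by apply: g'; rewrite inE eqxx.
  by apply: g'; rewrite inE w_ws' orbT.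
- rewrite /= /ends /= -/(ends h _) -[_ :: _ :: ends _ _]/([:: _; _] ++ _).
  rewrite -[a :: _]/([:: _; _] ++ [:: _; _] ++ _) perm_sym perm_catCA perm_cat2l perm_sym.
  exact: pe.
- by rewrite /chain /= !big_cons /= -!/(chain _ _) e addrCA.
- by rewrite /weight big_cons -!/(weight _) ew addnCA.
Qed.

Hypothesis k_gt0 : (0 < k)%N.

(** A difference of potentials is the class of two runs from the origin, whose syndrome is the sum
    of their end points, the origin cancelling. *)
Lemma syndrome_chain n L (x : {set edge}) v : cl x = chain n L ->
  (v \in syndrome x) = odd (count_mem v (ends n L)).
Proof.
elim: L x => [|w L IH] x.
  rewrite /chain big_nil -(cl0 k) => /(syndrome_cl k_gt0) ->.
  by rewrite syndrome0 inE.
rewrite /chain big_cons => ex.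
pose e := symd (run k (n * w.1.1) (n * w.1.2)) (run k (n * w.2.1) (n * w.2.2)).
have /IH : cl (symd x e) = chain n L.
  have ee : cl e = ptl n w.1 + ptl n w.2 by rewrite clD.
  rewrite clD ex ee -/(chain n L).
  by move: (ptl n w.1) (ptl n w.2) (chain n L) => x1 x2 x3; char2.
rewrite !in_syndromeD !syndrome_run // => exe.
rewrite /ends /= -/(ends n L) !oddD -exe /vtx !(eq_sym _ v).
by do 3!case: (v == _); case: (v \in _).
Qed.

Lemma ptl_shift p u : ptl h (shift p u) = ptl h p + ptl (2 * h) (lat u).
Proof.
rewrite /ptl /shift /= !mulnDr !(mulnA h (2 * (2 * c))%N) hc pot_shift //.
by congr (_ + pot _ _ _); rewrite -hc; lia.
Qed.

(** The lifts of [a] and [b] that come with the pass need not be the ends of the walks to be joined;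
    translations by periods bring the latter into a common D cell. *)
Lemma passP a b F p q : pass a b F -> vtx h p = a -> vtx h q = b ->
  exists u v, cellD (shift p u) = cellD (shift q v) /\
              F = ptl h (shift q v) - ptl h (shift p u).
Proof.
move=> [p0 [q0 [ep eq eD ->]]]; rewrite -ep -eq => /vtx_eq[u [t e]] /vtx_eq[u' [t' e']].
have addS x y z : shift (shift x y) z = shift x (y.1 + z.1, y.2 + z.2)%N.
  by rewrite /shift /=; congr (_, _); lia.
have e1 : shift p (u.1 + t'.1, u.2 + t'.2)%N = shift p0 (t.1 + t'.1, t.2 + t'.2)%N.
  by rewrite -!addS e.
have e2 : shift q (u'.1 + t.1, u'.2 + t.2)%N = shift q0 (t.1 + t'.1, t.2 + t'.2)%N.
  by rewrite -addS e' addS; congr shift; congr (_, _); lia.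
exists (u.1 + t'.1, u.2 + t'.2)%N, (u'.1 + t.1, u'.2 + t.2)%N.
rewrite e1 e2 !cellD_shift eD !ptl_shift; split=> //.
by rewrite opprD addrACA subrr addr0.
Qed.

(** The pass joins a walk end at [a] to a walk end at [b] at no cost in the bound [B]. If these are
    the two ends of one walk, it closes up; otherwise two walks become one. *)
Lemma state_merge a b r F X B : pass a b F ->
  state (a :: b :: r) X B -> state r (X + F) B.
Proof.
move=> paF [ws [L [g pe pr eX bB]]].
have /(pick_end g) [p [q [W [ws1 [g1 ea pe1 e1 w1]]]]] : a \in ends h [seq w.1 | w <- ws].
  by rewrite (perm_mem pe) inE eqxx.
have gw : good p q W by apply: (g1 ((p, q), W)); rewrite inE eqxx.
have {}g1 w : w \in ws1 -> good_walk w by move=> w_ws1; apply: g1; rewrite inE w_ws1 orbT.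
have {}pe : perm_eq (vtx h p :: ends h [seq w.1 | w <- ws1]) (b :: r).
  by rewrite -(perm_cons a) -(permPl pe1).
have [eb|nb] := eqVneq (vtx h p) b.
  have {}pe : perm_eq (ends h [seq w.1 | w <- ws1]) r by rewrite eb perm_cons in pe.
  have [u [v [eD eF]]] := passP paF ea eb.
  have eXF : chain h [seq w.1 | w <- ws1] + (ptl (2 * h) (lat v) - ptl (2 * h) (lat u))
      + chain (2 * h) L = X + F.
    rewrite -eX e1 eF !ptl_shift.
    move: (ptl h p) (ptl h q) (ptl _ (lat u)) (ptl _ (lat v)) (chain h _) (chain _ L) => x1 x2 x3 x4 x5 x6.
    by char2.
  (* A closed walk that does not wind has class 0 and is dropped; a winding one becomes a piece of
     the next level, paid for by [good_closed]. *)
  have [euv|nuv] := eqVneq (lat u) (lat v).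
    exists ws1, L; split=> //; first by rewrite -eXF euv subrr addr0.
    by apply: leq_trans bB; rewrite w1; lia.
  exists ws1, ((lat u, lat v) :: L); split=> //.
  - by rewrite /proper_pieces /= nuv.
  - by rewrite -eXF /chain big_cons /= addrA.
  apply: leq_trans bB; rewrite w1 /phi big_cons /= -/(phi L).
  have := @good_closed p q W (c * u.1, c * u.2)%N (c * v.1, c * v.2)%N gw.
  move: eD nuv; rewrite !cellD_shift /lat /= !mulnA => -[d1 d2] nuv.
  have ncuv : (c * u.1, c * u.2)%N <> (c * v.1, c * v.2)%N.
    by move=> [f1 f2]; case/eqP: nuv; rewrite -!mulnA f1 f2.
  move=> /(_ ncuv d1 d2); lia.
have : b \in ends h [seq w.1 | w <- ws1].
  by have := perm_mem pe b; rewrite !inE eqxx eq_sym (negbTE nb).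
move/(pick_end g1) => [q' [p' [W' [ws2 [g2 eb pe2 e2 w2]]]]].
have gw' : good p' q' W'.
  by apply: good_sym; apply: (g2 ((q', p'), W')); rewrite inE eqxx.
have {}g2 w : w \in ws2 -> good_walk w by move=> w_ws2; apply: g2; rewrite inE w_ws2 orbT.
have [u [v [eD eF]]] := passP paF ea eb.
exists (((shift p u, shift q' v), (W + W')%N) :: ws2), L; split=> //.
- move=> w; rewrite inE => /orP[/eqP ->|/g2 //].
  by apply: (good_cat eD); apply: good_shift.
- rewrite /= /ends /= -/(ends h _) !vtx_shift -(perm_cons b); apply: perm_trans pe.
  rewrite -[b :: _]/([:: b] ++ [:: _] ++ _) perm_catCA /= perm_cons perm_sym.
  exact: pe2.
- rewrite /= /chain big_cons /= -!/(chain _ _) -eX e1 e2 eF !ptl_shift.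
  move: (ptl h p) (ptl h q) (ptl h p') (ptl h q') (ptl _ (lat u)) (ptl _ (lat v)) (chain h _) (chain _ L).
  by move=> *; char2.
- by rewrite /weight big_cons -/(weight _) /=; move: bB; rewrite w1 w2; lia.
Qed.

End Walks.

(** * Blocks in the coordinates of A and D cells *)

Definition square : seq (bool * bool) :=
  [:: (false, false); (false, true); (true, false); (true, true)].

Section Cells.
Variable k : nat.
Local Notation N := (Defs.N k).
Local Notation vert := (Defs.vert k).
Local Notation edge := (Defs.edge k).
Local Notation mkv := (Defs.mkv k).

Variables h c : nat.
Hypothesis hc : h * (2 * (2 * c)) = N.

Let h_pos : 0 < h. Proof. exact: (@h_gt0 k h c hc). Qed.

(** Vertices of the two by two square at offset [(ox, oy)] from the block corner, in units of [h];
    one offset gives the A cells, another the D cells. *)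
Definition cell_lift ox oy (v : vert) (s : bool * bool) : point :=
  (v.1 %/ h + (ox + s.1), v.2 %/ h + (oy + s.2)).

Definition corner ox oy v s : vert := vtx k h (cell_lift ox oy v s).

Lemma cornersP (v : vert) : v \in corners k h ->
  exists a b, [/\ v.1 = h * (2 * a) :> nat, v.2 = h * (2 * b) :> nat,
    v.1 %/ h = 2 * a, v.2 %/ h = 2 * b & (a < 2 * c) && (b < 2 * c)].
Proof.
rewrite inE => /andP[/dvdnP[a ea] /dvdnP[b eb]]; exists a, b.
have ea' : v.1 = h * (2 * a) :> nat by rewrite ea; lia.
have eb' : v.2 = h * (2 * b) :> nat by rewrite eb; lia.
split=> //; rewrite ?ea' ?eb' ?mulKn //.
have := ltn_ord v.1; have := ltn_ord v.2; rewrite ea' eb' -hc !ltn_pmul2l //.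
by move=> -> ->.
Qed.

Lemma vtx_val (v : vert) a b : v.1 = h * a :> nat -> v.2 = h * b :> nat ->
  v = vtx k h (a, b).
Proof. by move=> ea eb; rewrite -[LHS]mkv_val ea eb. Qed.

(** Squares at one fixed offset are disjoint: modulo [4 * c], removing the offset leaves [2 * x + t]
    with a bit [t], which determines [x] and [t]. *)
Lemma corner_inj ox oy v v' s s' : v \in corners k h -> v' \in corners k h ->
  corner ox oy v s = corner ox oy v' s' -> v = v' /\ s = s'.
Proof.
move=> /cornersP[a [b [ea eb da db /andP[ha hb]]]].
move=> /cornersP[a' [b' [ea' eb' da' db' /andP[ha' hb']]]].
move/eqP; rewrite /corner /vtx /cell_lift /= da db da' db' mkv_eq.
have mdE x y o (t t' : bool) : x < 2 * c -> y < 2 * c ->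
    h * (2 * x + (o + t)) == h * (2 * y + (o + t')) %[mod N] -> x = y /\ t = t'.
  move=> hx hy; rewrite -hc -!muln_modr eqn_pmul2l //.
  rewrite (addnC o t) (addnC o t') !addnA eqn_modDr !modn_small; [|lia|lia].
  by case: t; case: t' => /= /eqP; split => //; lia.
move=> /andP[/mdE[] // e1 t1 /mdE[] // e2 t2].
rewrite (vtx_val ea eb) (vtx_val ea' eb') e1 e2; split=> //.
by move: s s' t1 t2 => [? ?] [? ?] /= -> ->.
Qed.

Lemma corner_surj ox oy p : exists2 v, v \in corners k h &
  exists2 s, s \in square & vtx k h p = corner ox oy v s.
Proof.
have c_gt0 : 0 < c by case: c hc (N_gt0 k) => // <-; rewrite !muln0.
(* The residue of [x - o]; adding [o] periods first keeps the subtraction in [nat]. *)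
pose r o x := (x + 2 * (2 * c) * o - o) %% (2 * (2 * c)).
have ltr o x : r o x < 2 * (2 * c) by rewrite ltn_pmod //; lia.
have rE o x : x = 2 * (r o x)./2 + (o + odd (r o x)) %[mod 2 * (2 * c)].
  have -> : 2 * (r o x)./2 + (o + odd (r o x)) = r o x + o by lia.
  rewrite modnDml subnK; last by rewrite -{1}(mul1n o); nia.
  by rewrite -modnDmr modnMr addn0.
pose v := vtx k h (2 * (r ox p.1)./2, 2 * (r oy p.2)./2).
have v1 : v.1 = h * (2 * (r ox p.1)./2) :> nat.
  by rewrite /= modn_small // -hc ltn_pmul2l //; have := ltr ox p.1; lia.
have v2 : v.2 = h * (2 * (r oy p.2)./2) :> nat.
  by rewrite /= modn_small // -hc ltn_pmul2l //; have := ltr oy p.2; lia.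
have dv a : 2 * h %| h * (2 * a) by rewrite mulnA (mulnC h 2) dvdn_mulr.
exists v; first by rewrite inE v1 v2 !dv.
exists (odd (r ox p.1), odd (r oy p.2)).
  by case: (odd _); case: (odd _).
rewrite /corner /cell_lift v1 v2 !mulKn //; apply: mkvP; rewrite /= -hc -!muln_modr -rE //.
Qed.

Definition corners_of ox oy (P : pred vert) v : seq vert :=
  [seq u <- [seq corner ox oy v s | s <- square] | P u].

Lemma corners_of_perm ox oy (S : {set vert}) :
  (forall u, u \in S -> exists p, u = vtx k h p) ->
  perm_eq (enum S) (flatten [seq corners_of ox oy (mem S) v | v <- enum (corners k h)]).
Proof.
move=> SV; apply: uniq_perm; first exact: enum_uniq.
  rewrite (eq_map (g := filter (mem S) \o (fun v => [seq corner ox oy v s | s <- square]))) //.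
  rewrite map_comp -filter_flatten filter_uniq // allpairs_uniq ?enum_uniq //.
  move=> x y /allpairsP[[v s] [vC _ ->]] /allpairsP[[v' s'] [vC' _ ->]] /= e.
  rewrite !mem_enum in vC vC'.
  by have [/= -> ->] := corner_inj vC vC' e.
move=> u; rewrite mem_enum; apply/idP/flatten_mapP => [uS|[v _]]; last first.
  by rewrite mem_filter => /andP[].
have [p ep] := SV u uS; have [v vC [s sq e]] := corner_surj ox oy p.
exists v; first by rewrite mem_enum.
rewrite mem_filter; apply/andP; split; first exact: uS.
by rewrite ep e; apply: map_f.
Qed.

Lemma hpath_eq x y x' y' len : mkv x y = mkv x' y' -> hpath k x y len = hpath k x' y' len.
Proof.
move/eqP; rewrite mkv_eq => /andP[/eqP ex /eqP ey].
apply: eq_imset => j; congr (_, _); apply: mkvP => //.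
by rewrite -modnDml ex modnDml.
Qed.

Lemma vpath_eq x y x' y' len : mkv x y = mkv x' y' -> vpath k x y len = vpath k x' y' len.
Proof.
move/eqP; rewrite mkv_eq => /andP[/eqP ex /eqP ey].
apply: eq_imset => j; congr (_, _); apply: mkvP => //.
by rewrite -modnDml ey modnDml.
Qed.

Let h_le : h <= N. Proof. by rewrite -hc leq_pmulr //; case: c hc (N_gt0 k) => // <-; rewrite !muln0. Qed.

Local Open Scope ring_scope.

Lemma cl_hpath_vtx (k_gt0 : (0 < k)%N) x y p : mkv x y = vtx k h p ->
  cl (hpath k x y h) = ptl k h (p.1.+1, p.2) - ptl k h p.
Proof. by move/hpath_eq ->; rewrite cl_hpath // /ptl /= mulnSr. Qed.

Lemma cl_vpath_vtx x y p : mkv x y = vtx k h p ->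
  cl (vpath k x y h) = ptl k h (p.1, p.2.+1) - ptl k h p.
Proof. by move/vpath_eq ->; rewrite cl_vpath // /ptl /= mulnSr. Qed.

End Cells.

(** * Vertices of the D and A cells of a block *)

Section Geometry.
Variable k : nat.
Local Notation N := (Defs.N k).
Local Notation vert := (Defs.vert k).
Local Notation edge := (Defs.edge k).
Local Notation mkv := (Defs.mkv k).

Variables h c : nat.
Hypothesis hc : h * (2 * (2 * c)) = N.

Let h_pos : 0 < h. Proof. exact: (@h_gt0 k h c hc). Qed.
Let c_pos : 0 < c. Proof. by case: c hc (N_gt0 k) => // <-; rewrite !muln0. Qed.

Notation ff := (false, false).
Notation ft := (false, true).
Notation tf := (true, false).
Notation tt := (true, true).

(* Vertices of the D cell and of the A cell of the block with corner [v]; whole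
   periods [4 c] are added to [y - 2] and [y - 1] to stay in [nat]. *)
Definition liftD (v : vert) s := cell_lift h 1 (8 * c - 2) v s.
Definition liftA (v : vert) s := cell_lift h 0 (4 * c - 1) v s.
Definition cornerD (v : vert) s := corner h 1 (8 * c - 2) v s.
Definition cornerA (v : vert) s := corner h 0 (4 * c - 1) v s.

(** Step 2 tests both vertical sides of C and both horizontal sides of B. The left side of C is the
    right side of the D cell of the block to the west, and the top of B is the bottom of the D cell
    of the block to the north; so each side of every D cell is tested exactly once. *)
Definition west (v : vert) : vert := mkv (v.1 + N - 2 * h) v.2.
Definition north (v : vert) : vert := mkv v.1 (v.2 + 2 * h).

Lemma corner_mkv ox oy v s : v \in corners k h ->
  corner h ox oy v s = mkv (v.1 + (ox + s.1) * h) (v.2 + (oy + s.2) * h).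
Proof.
case/(cornersP hc) => a [b [ea eb da db _]].
by rewrite /corner /vtx /cell_lift /= da db ea eb !(mulnDr h (2 * _)) !(mulnC h (_ + _)).
Qed.

Lemma eq_mod_shift i j x y : x + N * i = y + N * j -> x = y %[mod N].
Proof. by rewrite !(mulnC N) => e; rewrite -(modnMDl i) addnC e addnC modnMDl. Qed.

Lemma mem_west v : (west v \in corners k h) = (v \in corners k h).
Proof.
rewrite !inE /= (modn_small (ltn_ord v.2)); congr (_ && _).
have dN : 2 * h %| N by rewrite -hc; apply/dvdnP; exists (2 * c); lia.
rewrite /dvdn modn_dvdm // -!/(dvdn _ _) -addnBA ?dvdn_addl ?dvdn_subr //.
all: by apply: dvdn_leq => //; exact: N_gt0.
Qed.

Lemma mem_north v : (north v \in corners k h) = (v \in corners k h).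
Proof.
rewrite !inE /= (modn_small (ltn_ord v.1)); congr (_ && _).
have dN : 2 * h %| N by rewrite -hc; apply/dvdnP; exists (2 * c); lia.
by rewrite /dvdn modn_dvdm // -!/(dvdn _ _) dvdn_addl.
Qed.

Lemma west_inj : injective west.
Proof.
have le2 : 2 * h <= N by rewrite -hc; nia.
move=> v w /eqP; rewrite mkv_eq -!addnBA // eqn_modDr => /andP[/eqP e1 /eqP e2].
by rewrite -(mkv_val v) -(mkv_val w); apply: mkvP.
Qed.

Lemma north_inj : injective north.
Proof.
move=> v w /eqP; rewrite mkv_eq eqn_modDr => /andP[/eqP e1 /eqP e2].
by rewrite -(mkv_val v) -(mkv_val w); apply: mkvP.
Qed.

Section Block.
Variable v : vert.
Hypothesis vC : v \in corners k h.

Lemma cornerD_ft : mkv (v.1 + h) (v.2 + N - h) = cornerD v ft.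
Proof.
rewrite /cornerD corner_mkv //.
by apply: mkvP; [apply: (@eq_mod_shift 0 0) | apply: (@eq_mod_shift 1 0)];
  rewrite /=; move: hc c_pos h_pos; nia.
Qed.

Lemma cornerD_tt : mkv (v.1 + h + h) (v.2 + N - h) = cornerD v tt.
Proof.
rewrite /cornerD corner_mkv //.
by apply: mkvP; [apply: (@eq_mod_shift 0 0) | apply: (@eq_mod_shift 1 0)];
  rewrite /=; move: hc c_pos h_pos; nia.
Qed.

Lemma cornerD_ff : mkv (v.1 + h) (v.2 + N - h + N - h) = cornerD v ff.
Proof.
rewrite /cornerD corner_mkv //.
by apply: mkvP; [apply: (@eq_mod_shift 0 0) | apply: (@eq_mod_shift 0 0)];
  rewrite /=; move: hc c_pos h_pos; nia.
Qed.

Lemma cornerD_tf : mkv (v.1 + h + h) (v.2 + N - h + N - h) = cornerD v tf.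
Proof.
rewrite /cornerD corner_mkv //.
by apply: mkvP; [apply: (@eq_mod_shift 0 0) | apply: (@eq_mod_shift 0 0)];
  rewrite /=; move: hc c_pos h_pos; nia.
Qed.

Lemma cornerD_west_tt : mkv v.1 (v.2 + N - h) = cornerD (west v) tt.
Proof.
rewrite /cornerD corner_mkv ?mem_west //; apply: mkvP; rewrite /= modnDml.
  by apply: (@eq_mod_shift 1 0); move: hc c_pos h_pos; nia.
by apply: (@eq_mod_shift 1 0); move: hc c_pos h_pos; nia.
Qed.

Lemma cornerD_west_tf : mkv v.1 (v.2 + N - h + N - h) = cornerD (west v) tf.
Proof.
rewrite /cornerD corner_mkv ?mem_west //; apply: mkvP; rewrite /= modnDml.
  by apply: (@eq_mod_shift 1 0); move: hc c_pos h_pos; nia.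
by apply: (@eq_mod_shift 0 0); move: hc c_pos h_pos; nia.
Qed.

Lemma cornerD_north_ff : mkv (v.1 + h) v.2 = cornerD (north v) ff.
Proof.
rewrite /cornerD corner_mkv ?mem_north //; apply: mkvP; rewrite /= modnDml.
  by apply: (@eq_mod_shift 0 0); move: hc c_pos h_pos; nia.
by apply: (@eq_mod_shift 2 0); move: hc c_pos h_pos; nia.
Qed.

Lemma cornerD_north_tf : mkv (v.1 + h + h) v.2 = cornerD (north v) tf.
Proof.
rewrite /cornerD corner_mkv ?mem_north //; apply: mkvP; rewrite /= modnDml.
  by apply: (@eq_mod_shift 0 0); move: hc c_pos h_pos; nia.
by apply: (@eq_mod_shift 2 0); move: hc c_pos h_pos; nia.
Qed.

Lemma cornerA_ft : mkv v.1 v.2 = cornerA v ft.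
Proof.
rewrite /cornerA corner_mkv //.
by apply: mkvP; [apply: (@eq_mod_shift 0 0) | apply: (@eq_mod_shift 1 0)];
  rewrite /=; move: hc c_pos h_pos; nia.
Qed.

Lemma cornerA_tt : mkv (v.1 + h) v.2 = cornerA v tt.
Proof.
rewrite /cornerA corner_mkv //.
by apply: mkvP; [apply: (@eq_mod_shift 0 0) | apply: (@eq_mod_shift 1 0)];
  rewrite /=; move: hc c_pos h_pos; nia.
Qed.

Lemma cornerA_ff : mkv v.1 (v.2 + N - h) = cornerA v ff.
Proof.
rewrite /cornerA corner_mkv //.
by apply: mkvP; [apply: (@eq_mod_shift 0 0) | apply: (@eq_mod_shift 0 0)];
  rewrite /=; move: hc c_pos h_pos; nia.
Qed.

Lemma cornerA_tf : mkv (v.1 + h) (v.2 + N - h) = cornerA v tf.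
Proof.
rewrite /cornerA corner_mkv //.
by apply: mkvP; [apply: (@eq_mod_shift 0 0) | apply: (@eq_mod_shift 0 0)];
  rewrite /=; move: hc c_pos h_pos; nia.
Qed.
End Block.

End Geometry.

Section Pairing.
Variable k : nat.
Hypothesis k_gt0 : 0 < k.
Local Notation N := (Defs.N k).
Local Notation vert := (Defs.vert k).
Local Notation edge := (Defs.edge k).
Local Notation mkv := (Defs.mkv k).

Variables h c : nat.
Hypothesis hc : h * (2 * (2 * c)) = N.

Notation ff := (false, false).
Notation ft := (false, true).
Notation tf := (true, false).
Notation tt := (true, true).
Local Notation cornerD := (@cornerD k h c).
Local Notation liftD := (@liftD k h c).
Local Notation C := (corners k h).

Lemma cornerD_eq v v' s s' : v \in C -> v' \in C ->
  (cornerD v s == cornerD v' s') = (v == v') && (s == s').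
Proof.
move=> vC v'C; apply/eqP/andP => [/(corner_inj hc vC v'C)[-> ->] //|].
by case=> /eqP -> /eqP ->.
Qed.

Lemma big_west (R : Type) (idx : R) (op : Monoid.com_law idx) (f : vert -> R) :
  \big[op/idx]_(v in C) f (west h v) = \big[op/idx]_(v in C) f v.
Proof.
rewrite [RHS](reindex_inj (west_inj hc)) /=.
by apply: eq_bigl => v; rewrite (mem_west hc).
Qed.

Lemma big_north (R : Type) (idx : R) (op : Monoid.com_law idx) (f : vert -> R) :
  \big[op/idx]_(v in C) f (north h v) = \big[op/idx]_(v in C) f v.
Proof.
rewrite [RHS](reindex_inj (@north_inj k h)) /=.
by apply: eq_bigl => v; rewrite (mem_north hc).
Qed.

Lemma mem_bigcup_cornerD (R : vert -> {set vert}) v s :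
  (forall v' u, v' \in C -> u \in R v' -> exists s', u = cornerD v' s') ->
  v \in C -> (cornerD v s \in \bigcup_(v' in C) R v') = (cornerD v s \in R v).
Proof.
move=> RP vC; apply/bigcupP/idP => [[v' v'C uR]|uR]; last by exists v.
have [s' /eqP] := RP _ _ v'C uR.
by rewrite cornerD_eq // => /andP[/eqP e _]; rewrite {2}e.
Qed.

(** * Steps 1 and 2 *)

Definition both (S : {set vert}) a b v :=
  (cornerD v a \in S) && (cornerD v b \in S).
Definition pair_rem S a b v : {set vert} :=
  opt (both S a b v) [set cornerD v a; cornerD v b].

Lemma pair_remP S a b v u : u \in pair_rem S a b v -> exists s, u = cornerD v s.
Proof.
rewrite /pair_rem /opt; case: ifP => _; rewrite !inE // => /orP[] /eqP ->.
  by exists a.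
by exists b.
Qed.

Lemma mem_pair_rem S a b v s : v \in C ->
  (cornerD v s \in pair_rem S a b v) = both S a b v && ((s == a) || (s == b)).
Proof.
move=> vC; rewrite /pair_rem /opt; case: ifP => _; rewrite !inE //.
by rewrite !cornerD_eq // eqxx.
Qed.

Lemma step1_remE S v : v \in C -> step1_rem h S v.1 v.2 =
  pair_rem S ft tf v :|: pair_rem S tt ff v.
Proof.
move=> vC; rewrite /step1_rem /s1_p1 /s1_p2 /c_al /c_be /c_ga /c_de.
by rewrite (cornerD_ft hc) // (cornerD_tt hc) // (cornerD_ff hc) // (cornerD_tf hc).
Qed.

Lemma step2_remE S v : v \in C -> step2_rem h S v.1 v.2 =
  pair_rem S tt tf (west h v) :|: pair_rem S ft ff v
  :|: pair_rem S ff tf (north h v) :|: pair_rem S ft tt v.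
Proof.
move=> vC; rewrite /step2_rem /s2_C1 /s2_C2 /s2_B1 /s2_B2 /c_al /c_be /c_ga /c_de.
rewrite (cornerD_ft hc) // (cornerD_tt hc) // (cornerD_ff hc) //.
rewrite (cornerD_west_tt hc) // (cornerD_west_tf hc) //.
by rewrite (cornerD_north_ff hc) // (cornerD_north_tf hc).
Qed.

Variable S : {set vert}.
Let S1 := S :\: \bigcup_(v in C) step1_rem h S v.1 v.2.
Let S2 := S1 :\: \bigcup_(v in C) step2_rem h S1 v.1 v.2.

Let g v s := cornerD v s \in S.
Let g1 v s := cornerD v s \in S1.

Lemma mem_S1 v s : v \in C -> g1 v s = g v s && ~~ g v (~~ s.1, ~~ s.2).
Proof.
move=> vC; rewrite /g1 /S1 in_setD mem_bigcup_cornerD //; last first.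
  by move=> v' u v'C; rewrite step1_remE // inE => /orP[] /pair_remP.
rewrite step1_remE // inE !mem_pair_rem // /both -!/(g v _).
by case: s => [[] []] /=; case: (g v ff); case: (g v ft); case: (g v tf); case: (g v tt).
Qed.

Lemma mem_S2 v s : v \in C ->
  (cornerD v s \in S2) = [&& g1 v s, ~~ g1 v (~~ s.1, s.2) & ~~ g1 v (s.1, ~~ s.2)].
Proof.
move=> vC; rewrite /S2 in_setD -/(g1 v s).
pose R w := pair_rem S1 tt tf w :|: pair_rem S1 ft ff w
  :|: pair_rem S1 ff tf w :|: pair_rem S1 ft tt w.
have -> : \bigcup_(w in C) step2_rem h S1 w.1 w.2 = \bigcup_(w in C) R w.
  rewrite (eq_bigr _ (fun w wC => step2_remE S1 wC)) !big_split /=.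
  by rewrite (big_west _ (pair_rem S1 tt tf)) (big_north _ (pair_rem S1 ff tf)).
rewrite mem_bigcup_cornerD //; last first.
  by move=> v' u _; rewrite !inE => /orP[/orP[/orP[]|]|] /pair_remP.
rewrite !inE !mem_pair_rem // /both -!/(g1 v _).
by case: s => [[] []] /=; case: (g1 v ff); case: (g1 v ft); case: (g1 v tf); case: (g1 v tt).
Qed.

(** Step 1 leaves no opposite pair in a D cell, hence at most two vertices, and those adjacent; step
    2 removes such a pair. *)
Lemma mem_S2_unique v s s' : v \in C ->
  cornerD v s \in S2 -> cornerD v s' \in S2 -> s = s'.
Proof.
move=> vC; rewrite !mem_S2 // !mem_S1 //.
by case: s => [[] []]; case: s' => [[] []] //=;
  case: (g v ff); case: (g v ft); case: (g v tf); case: (g v tt).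
Qed.

Local Open Scope ring_scope.

Definition hop v a b := ptl k h (liftD v b) - ptl k h (liftD v a).

Lemma pass_hop v a b : v \in C -> pass h (cornerD v a) (cornerD v b) (hop v a b).
Proof.
move=> vC; exists (liftD v a), (liftD v b); split=> //.
case/(cornersP hc): vC => x [y [_ _ ex ey _]].
rewrite /cellD /liftD /cell_lift /= ex ey; case: a => [[] []]; case: b => [[] []] /=;
  congr (_, _); lia.
Qed.

Lemma cl_hhop x y v b : mkv x y = cornerD v (false, b) ->
  cl (hpath k x y h) = hop v (false, b) (true, b).
Proof.
move/(cl_hpath_vtx hc k_gt0) ->; rewrite /hop; congr (ptl k h _ - _).
by rewrite /liftD /cell_lift /=; congr (_, _); rewrite -addnS.
Qed.

Lemma cl_vhop x y v a : mkv x y = cornerD v (a, false) ->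
  cl (vpath k x y h) = hop v (a, false) (a, true).
Proof.
move/(cl_vpath_vtx hc) ->; rewrite /hop; congr (ptl k h _ - _).
by rewrite /liftD /cell_lift /=; congr (_, _); rewrite -addnS addn0 addn1.
Qed.

Definition hop_if (T : {set vert}) a b v F : 'rV[bool]_#|{: edge}| :=
  if both T a b v then F else 0.

Lemma cl_step1 v : v \in C -> cl (step1_flip h S v.1 v.2) =
  hop_if S ft tf v (hop v ff ft + hop v ff tf)
  + hop_if S tt ff v (hop v ff tf + hop v tf tt).
Proof.
move=> vC; rewrite /step1_flip /s1_p1 /s1_p2 /c_al /c_be /c_ga /c_de /c_l /c_b /c_r.
rewrite clD !cl_opt !clD (cl_vhop (cornerD_ff hc vC)) (cl_hhop (cornerD_ff hc vC)).
rewrite (cl_vhop (cornerD_tf hc vC)).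
by rewrite (cornerD_ft hc) // (cornerD_tt hc) // (cornerD_ff hc) // (cornerD_tf hc).
Qed.

Lemma cl_step2 (T : {set vert}) v : v \in C -> cl (step2_flip h T v.1 v.2) =
  hop_if T tt tf (west h v) (hop (west h v) tf tt) + hop_if T ft ff v (hop v ff ft)
  + (hop_if T ff tf (north h v) (hop (north h v) ff tf)
     + hop_if T ft tt v (hop v ft tt)).
Proof.
move=> vC; rewrite /step2_flip /s2_C1 /s2_C2 /s2_B1 /s2_B2.
rewrite /c_al /c_be /c_ga /c_de /c_l /c_b /c_r /c_t.
rewrite !clD !cl_opt (cl_vhop (cornerD_west_tf hc vC)) (cl_vhop (cornerD_ff hc vC)).
rewrite (cl_hhop (cornerD_north_ff hc vC)) (cl_hhop (cornerD_ft hc vC)).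
rewrite (cornerD_ft hc) // (cornerD_tt hc) // (cornerD_ff hc) //.
rewrite (cornerD_west_tt hc) // (cornerD_west_tf hc) //.
by rewrite (cornerD_north_ff hc) // (cornerD_north_tf hc).
Qed.

Definition block_hop v :=
  hop_if S ft tf v (hop v ff ft + hop v ff tf)
  + hop_if S tt ff v (hop v ff tf + hop v tf tt)
  + (hop_if S1 tt tf v (hop v tf tt) + hop_if S1 ft ff v (hop v ff ft)
     + (hop_if S1 ff tf v (hop v ff tf) + hop_if S1 ft tt v (hop v ft tt))).

Lemma cl_step12 :
  cl (\big[@symd _/set0]_(v in C) step1_flip h S v.1 v.2)
  + cl (\big[@symd _/set0]_(v in C) step2_flip h S1 v.1 v.2)
  = \sum_(v in C) block_hop v.
Proof.
rewrite !cl_sum (eq_bigr _ cl_step1) (eq_bigr _ (cl_step2 S1)) !big_split /=.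
rewrite (big_west _ (fun w => hop_if S1 tt tf w (hop w tf tt))).
by rewrite (big_north _ (fun w => hop_if S1 ff tf w (hop w ff tf))).
Qed.

Lemma state_block v r X B : v \in C ->
  state h (corners_of h 1 (8 * c - 2) (mem S) v ++ r) X B ->
  state h (corners_of h 1 (8 * c - 2) (mem S2) v ++ r) (X + block_hop v) B.
Proof.
move=> vC.
have merge a b t F : state h (cornerD v a :: cornerD v b :: t) X B ->
    hop v a b = F -> state h t (X + F) B.
  by move=> st <-; apply: (state_merge hc k_gt0) st; apply: pass_hop.
(* Step 1 flips two sides of the D cell; their class is that of a hop along the diagonal. *)
have e1 : hop v ft tf = hop v ff ft + hop v ff tf.
  by rewrite /hop; move: (ptl _ _ _) (ptl _ _ _) (ptl _ _ _) => *; char2.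
have e2 : hop v ff tt = hop v ff tf + hop v tf tt.
  by rewrite /hop; move: (ptl _ _ _) (ptl _ _ _) (ptl _ _ _) => *; char2.
rewrite /corners_of /square /= -!/(cornerD v _).
rewrite !mem_S2 // /block_hop /hop_if /both -!/(g v _) -!/(g1 v _) !mem_S1 //=.
(* Sixteen contents of the D cell: with fewer than two vertices nothing happens, with two or three
   one pair is merged, with four both diagonals. *)
case: (g v ff); case: (g v ft); case: (g v tf); case: (g v tt) => /= st;
  rewrite ?addr0 ?add0r //.
- have st' : state h [:: cornerD v ff, cornerD v tt, cornerD v ft, cornerD v tf & r] X B.
    by apply: state_perm st; apply/permP => P /=; lia.
  rewrite -e1 -e2 [hop v ft tf + _]addrC addrA.
  apply: (state_merge hc k_gt0 (pass_hop ft tf vC)).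
  exact: merge st' _.
- by apply: (merge ft tf) => //; apply: state_perm st; apply/permP => P /=; lia.
- by apply: (merge ff tt) => //; apply: state_perm st; apply/permP => P /=; lia.
- exact: merge st _.
- by apply: (merge ff tt) => //; apply: state_perm st; apply/permP => P /=; lia.
- exact: merge st _.
- exact: merge st _.
- exact: merge st _.
- exact: merge st _.
- exact: merge st _.
- by apply: merge st _; rewrite /hop -opprB oppb2.
Qed.

Lemma state_blocks r X B :
  state h (flatten [seq corners_of h 1 (8 * c - 2) (mem S) v | v <- enum C] ++ r) X B ->
  state h (flatten [seq corners_of h 1 (8 * c - 2) (mem S2) v | v <- enum C] ++ r)
    (X + \sum_(v in C) block_hop v) B.
Proof.
rewrite -big_enum.
have: {subset enum C <= C} by move=> v; rewrite mem_enum.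
elim: (enum C) r X => [|v t IH] r X sC st; first by rewrite big_nil addr0.
have pC (s1 s2 s3 : seq vert) : perm_eq (s1 ++ s2 ++ s3) (s2 ++ s1 ++ s3).
  by rewrite perm_catCA.
rewrite big_cons addrA /= -catA; apply: (state_perm (pC _ _ _)).
apply: IH; first by move=> w wt; apply: sC; rewrite inE wt orbT.
apply: (state_perm (pC _ _ _)).
apply: state_block; first by apply: sC; rewrite inE eqxx.
by rewrite /= -catA in st.
Qed.

End Pairing.

(** * One level of the decoder *)

Lemma not_uniq_perm (T : eqType) (r : seq T) : ~~ uniq r ->
  exists a r', perm_eq r (a :: a :: r').
Proof.
elim: r => [//|x r IH] /=; rewrite negb_and negbK => /orP[xr|/IH[a [r' pr]]].
  by exists x, (rem x r); rewrite perm_cons perm_to_rem.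
exists a, (x :: r'); rewrite -(perm_cons x) in pr; apply: perm_trans pr _.
by apply/permP => P /=; lia.
Qed.

Section Level.
Variable k : nat.
Hypothesis k_gt0 : 0 < k.
Local Notation N := (Defs.N k).
Local Notation vert := (Defs.vert k).
Local Notation edge := (Defs.edge k).
Local Notation mkv := (Defs.mkv k).

Variables h c : nat.
Hypothesis hc : h * (2 * (2 * c)) = N.

Notation ff := (false, false).
Notation ft := (false, true).
Notation tf := (true, false).
Notation tt := (true, true).
Local Notation cornerD := (@cornerD k h c).
Local Notation liftD := (@liftD k h c).
Local Notation cornerA := (@cornerA k h c).
Local Notation liftA := (@liftA k h c).
Local Notation C := (corners k h).

Let h_pos : 0 < h. Proof. exact: (@h_gt0 k h c hc). Qed.
Let c_pos : 0 < c. Proof. by case: c hc (N_gt0 k) => // <-; rewrite !muln0. Qed.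

Lemma cellD_cornerD p q v s : v \in C -> cellD p = cellD q ->
  vtx k h p = cornerD v s -> exists s', vtx k h q = cornerD v s'.
Proof.
case/(cornersP hc) => x [y [_ _ ex ey _]] eD /(vtx_eq hc)[a [b e]].
have := cellD_shift hc q a; rewrite -eD -(cellD_shift hc) e => eDq.
(* A D cell starts at an odd abscissa and an even ordinate, hence the negation in the first
   coordinate only. *)
exists (~~ odd (shift c q a).1, odd (shift c q a).2).
rewrite -(vtx_shift hc q a) -[RHS](vtx_shift hc _ b); congr vtx.
move: eDq; rewrite /cellD /cell_lift /shift /= ex ey -!mulnA.
move: (c * a.1) (c * a.2) (c * b.1) (c * b.2).
by case: s {e} => s1 s2 a1 a2 b1 b2 /= [e1 e2]; congr (_, _); lia.
Qed.

Lemma mem_ends_vtx n (L : seq piece) (v : vert) : v \in ends k n L -> exists p, v = vtx k n p.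
Proof.
by case/flatten_mapP => w _; rewrite !inE => /orP[] /eqP ->; [exists w.1 | exists w.2].
Qed.

Lemma ends_neq n (L : seq piece) w : uniq (ends k n L) -> w \in L ->
  vtx k n w.1 != vtx k n w.2.
Proof.
elim: L => [//|w' L IH] /=; rewrite /ends /= !inE negb_or -/(ends k n L).
by move=> /and3P[/andP[nw _] _ u] /orP[/eqP -> //|/(IH u)].
Qed.

Local Open Scope ring_scope.

(** Two ends at the same vertex are merged through the trivial pass, which preserves parities. When
    [r] lists the ends of all pieces, what remains is exactly the syndrome, by [syndrome_chain]. *)
Lemma state_uniq (r : seq vert) X B : state h r X B ->
  exists r', [/\ uniq r', forall v, odd (count_mem v r') = odd (count_mem v r)
               & state h r' X B].
Proof.
have [n] := ubnP (size r); elim: n r => // n IH r; rewrite ltnS => le_r_n st.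
have [ur|/not_uniq_perm[a [r' pr]]] := boolP (uniq r); first by exists r.
have paa : pass h a a (0 : 'rV[bool]_#|{: edge}|).
  case: st => ws [_ [_ pe _ _ _]].
  have /mem_ends_vtx[p ->] : a \in ends k h [seq w.1 | w <- ws].
    by rewrite (perm_mem pe) (perm_mem pr) inE eqxx.
  by exists p, p; rewrite subrr.
have [|| r'' [u o st'']] := IH r'.
- by move: le_r_n; rewrite (perm_size pr) => /ltnW.
- by rewrite -[X]addr0; apply: (state_merge hc k_gt0 paa); apply: state_perm st.
exists r''; split=> // v; rewrite o (permP pr) /= addnA oddD addnn odd_double.
by [].
Qed.

Lemma state_start L : proper_pieces L ->
  state h (ends k h L) (chain k h L) (5 * phi L)%N.
Proof.
move=> pL; exists [seq (w, (1 + dist1 w.1 w.2)%N) | w <- L], [::].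
have e : [seq w.1 | w <- [seq (w, (1 + dist1 w.1 w.2)%N) | w <- L]] = L.
  by rewrite -map_comp map_id.
rewrite e; split=> //.
- move=> _ /mapP[w wL ->]; apply: good_single; last by rewrite /single.
  exact: (allP pL).
- by rewrite /chain big_nil addr0.
- by rewrite /phi big_nil muln0 /weight big_map.
Qed.

(** Class of a path from [u] to the top-left corner of its A cell, which is a vertex of the next
    level. *)
Definition collapse (u : vert) :=
  ptl k (2 * h) (cellA (u.1 %/ h, u.2 %/ h)%N) - ptl k h (u.1 %/ h, u.2 %/ h)%N.

(** The choice of lift does not matter, as a period adds the same class to both potentials. *)
Lemma collapse_vtx p :
  collapse (vtx k h p) = ptl k (2 * h) (cellA p) - ptl k h p.
Proof.
set p0 := (((vtx k h p).1 %/ h)%N, ((vtx k h p).2 %/ h)%N).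
have e : vtx k h p0 = vtx k h p.
  rewrite /p0 /= -hc -!muln_modr !mulKn //.
  by apply: mkvP; rewrite /= -hc -!muln_modr modn_mod.
have ptlA q u : ptl k (2 * h) (cellA (shift c q u)) =
    ptl k (2 * h) (cellA q) + ptl k (2 * h) (lat c u).
  have e2 a b : (2 * h * (a + 2 * c * b) = 2 * h * a + N * b)%N by rewrite -hc; lia.
  have e3 b : (2 * h * (2 * c * b) = N * b)%N by rewrite -hc; lia.
  by rewrite (cellA_shift hc) /ptl /= !e2 !e3 pot_shift.
have [a [b eab]] := vtx_eq hc e.
have := congr1 (fun q => ptl k (2 * h) (cellA q) - ptl k h q) eab.
have subDD (r s t : 'rV[bool]_#|{: edge}|) : (r + t) - (s + t) = r - s.
  by rewrite opprD addrACA subrr addr0.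
by rewrite !ptlA !(ptl_shift hc k_gt0) !subDD.
Qed.

Lemma cl_hstepA x y v b : mkv x y = cornerA v (false, b) ->
  cl (hpath k x y h) = ptl k h (liftA v (true, b)) - ptl k h (liftA v (false, b)).
Proof.
move/(cl_hpath_vtx hc k_gt0) ->; congr (ptl k h _ - _).
by rewrite /liftA /cell_lift /=; congr (_, _); rewrite -addnS.
Qed.

Lemma cl_vstepA x y v a : mkv x y = cornerA v (a, false) ->
  cl (vpath k x y h) = ptl k h (liftA v (a, true)) - ptl k h (liftA v (a, false)).
Proof.
move/(cl_vpath_vtx hc) ->; congr (ptl k h _ - _).
by rewrite /liftA /cell_lift /=; congr (_, _); rewrite -addnS addn0 addn1.
Qed.

(** Step 3 flips a path to the top-left corner of the A cell from each of its vertices in [T]; that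
    corner itself contributes 0. *)
Lemma cl_step3 (T : {set vert}) v : v \in C -> cl (step3_flip h T v.1 v.2) =
  \sum_(u <- corners_of h 0 (4 * c - 1) (mem T) v) collapse u.
Proof.
move=> vC; have [x [y [_ _ ex ey _]]] := cornersP hc vC.
have colE s : collapse (cornerA v s) = ptl k h (liftA v ft) - ptl k h (liftA v s).
  rewrite collapse_vtx; congr (_ - _); rewrite /ptl /cellA /cell_lift /= ex ey.
  have -> : ((2 * x + (0 + s.1))./2 = x)%N by lia.
  have -> : (uphalf (2 * y + (4 * c - 1 + s.2)) = y + 2 * c)%N by lia.
  have -> : (4 * c - 1 + 1 = 4 * c)%N by lia.
  by congr pot; lia.
rewrite /corners_of big_filter big_map /square !big_cons big_nil -!/(cornerA v _) !colE subrr.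
rewrite /step3_flip /c_be /c_ga /c_de /c_t /c_l /c_b !clD !cl_opt !clD.
rewrite (cl_hstepA (cornerA_ft hc vC)) (cl_vstepA (cornerA_ff hc vC)).
rewrite (cl_hstepA (cornerA_ff hc vC)).
rewrite (cornerA_tt hc) // (cornerA_ff hc) // (cornerA_tf hc) //=.
move: (ptl _ _ _) (ptl _ _ _) (ptl _ _ _) (ptl _ _ _) => p0 p1 p2 p3.
by do 4!case: (_ \in T); char2.
Qed.

Lemma cl_step3_sum (T : {set vert}) : (forall u, u \in T -> exists p, u = vtx k h p) ->
  cl (\big[@symd _/set0]_(v in C) step3_flip h T v.1 v.2) = \sum_(u in T) collapse u.
Proof.
move=> TV; rewrite cl_sum (eq_bigr _ (cl_step3 T)) -!big_enum.
by rewrite (perm_big _ (corners_of_perm hc 0 (4 * c - 1) TV)) big_flatten big_map.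
Qed.

(** A walk with both ends in one A cell vanishes; any other becomes a piece between its A cells. The
    hypothesis on D cells supplies what [good_open] needs: no walk left has both ends in one D
    cell. *)
Lemma state_collapse (T : {set vert}) X B :
  (forall v s s', v \in C -> cornerD v s \in T -> cornerD v s' \in T -> s = s') ->
  state h (enum T) X B ->
  exists L, [/\ proper_pieces L, chain k (2 * h) L = X + \sum_(u in T) collapse u
               & (6 * phi L <= B)%N].
Proof.
move=> T1 [ws [L [g pe pL eX bB]]].
pose low (w : walk) : piece := (cellA w.1.1, cellA w.1.2).
exists ([seq p <- [seq low w | w <- ws] | p.1 != p.2] ++ L); split.
- by rewrite /proper_pieces all_cat filter_all.
- rewrite -eX -big_enum -(perm_big _ pe) /chain big_cat /= addrAC; congr (_ + _).
  rewrite big_filter big_map big_mkcond /ends big_flatten !big_map -big_split /=.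
  apply: eq_bigr => -[[p q] W] _ /=; rewrite big_cons big_seq1 !collapse_vtx.
  case: eqP => [-> | _] /=.
    by move: (ptl _ _ (cellA q)) (ptl _ h p) (ptl _ h q) => *; char2.
  by move: (ptl _ _ (cellA p)) (ptl _ _ (cellA q)) (ptl _ h p) (ptl _ h q) => *; char2.
apply: leq_trans bB; rewrite /phi big_cat /= mulnDr addnC leq_add2l.
rewrite big_filter big_map /= big_mkcond /= /weight !big_distrr /=.
rewrite big_seq [X in (_ <= X)%N]big_seq; apply: leq_sum => -[[p q] W] w_ws /=.
case: ifP => [nA|_]; last by rewrite muln0.
(* Ends in one D cell would be the same vertex, but the ends of the walks enumerate [T] without
   repetition. *)
apply: (good_open (g _ w_ws)) => //=; apply/negP => /eqP eD.
have uE : uniq (ends k h [seq w.1 | w <- ws]) by rewrite (perm_uniq pe) enum_uniq.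
have pq_ws : (p, q) \in [seq w.1 | w <- ws] by apply/mapP; exists ((p, q), W).
have inT u : u \in [:: vtx k h p; vtx k h q] -> u \in T.
  move=> uin; rewrite -mem_enum -(perm_mem pe); apply/flatten_mapP.
  by exists (p, q).
have [v vC [s _ ep]] := corner_surj hc 1 (8 * c - 2) p.
have [s' eq] := cellD_cornerD vC eD ep.
have ss' : s = s'.
  by apply: (T1 v) => //; rewrite -?eq -?[cornerD v s]ep inT // !inE eqxx ?orbT.
by have := ends_neq uE pq_ws; rewrite /= eq ep ss' eqxx.
Qed.

(** The bound [5 * phi L] is set up by [state_start] and kept through all merges; the collapse turns
    it into the bound on [6 * phi L']. *)
Lemma reduction_pieces i L (x : {set edge}) : (h = 2 ^ (k - i))%N ->
  proper_pieces L -> cl x = chain k h L ->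
  exists L', [/\ proper_pieces L',
    cl (symd x (reduction i (syndrome x))) = chain k (2 * h) L'
    & (6 * phi L' <= 5 * phi L)%N].
Proof.
move=> hE pL ex; set S := syndrome x.
have SE v := syndrome_chain k_gt0 v ex.
have SV u : u \in S -> exists p, u = vtx k h p.
  rewrite SE => o; apply: (@mem_ends_vtx h L); rewrite -has_pred1 has_count.
  by case: count o.
have [r [ur or st]] := state_uniq (state_start pL).
have {}st : state h (enum S) (chain k h L) (5 * phi L).
  apply: state_perm st; apply: uniq_perm => //; first exact: enum_uniq.
  move=> v; rewrite mem_enum SE -or count_uniq_mem //.
  by case: (v \in r).
have := state_perm (corners_of_perm hc 1 (8 * c - 2) SV) st.
rewrite -[flatten _]cats0 => /(state_blocks k_gt0 hc); rewrite cats0.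
set S1 := S :\: _; set S2 := S1 :\: _ => {}st.
have S2V u : u \in S2 -> exists p, u = vtx k h p.
  by case/setDP => /setDP[/SV].
have /state_collapse[|L' [pL' eL' bL']] : state h (enum S2) (chain k h L +
    \sum_(v in C) block_hop h c S v) (5 * phi L).
- by apply: state_perm st; rewrite perm_sym; apply: (corners_of_perm hc).
- by move=> v s s' vC; apply: (mem_S2_unique hc vC).
exists L'; split=> //; rewrite eL' clD ex /reduction -hE -/S -/S1 -/S2 !clD.
by rewrite (cl_step3_sum S2V) -(cl_step12 k_gt0 hc) !addrA.
Qed.

End Level.

Section Decoder.
Variable k : nat.
Hypothesis k_gt0 : 0 < k.
Local Notation edge := (Defs.edge k).
Local Notation vert := (Defs.vert k).

(** * The decoder *)

Lemma reduction0 i : reduction i (set0 : {set vert}) = set0.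
Proof.
rewrite /reduction.
have z1 (v : vert) : step1_flip (2 ^ (k - i)) (set0 : {set vert}) v.1 v.2 = set0.
  by rewrite /step1_flip /s1_p1 /s1_p2 !inE !symd0.
have z2 (v : vert) : step2_flip (2 ^ (k - i)) (set0 : {set vert}) v.1 v.2 = set0.
  by rewrite /step2_flip /s2_C1 /s2_C2 /s2_B1 /s2_B2 !inE !symd0.
have z3 (v : vert) : step3_flip (2 ^ (k - i)) (set0 : {set vert}) v.1 v.2 = set0.
  by rewrite /step3_flip !inE !symd0.
have big0 (F : vert -> {set edge}) (D : {set vert}) : (forall v, F v = set0) ->
    \big[@symd _/set0]_(v in D) F v = set0.
  by move=> F0; elim/big_ind: _ => // A B -> ->; rewrite symd0.
by rewrite !set0D (big0 _ _ z1) (big0 _ _ z2) (big0 _ _ z3) !symd0.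
Qed.

Lemma dec_loop0 i : dec_loop i (set0 : {set vert}) = set0.
Proof. by case: i => //= i; rewrite eqxx. Qed.

Lemma dec_loopS i (S : {set vert}) : dec_loop i.+1 S =
  symd (reduction i.+1 S) (dec_loop i (symd S (syndrome (reduction i.+1 S)))).
Proof.
rewrite /=; case: eqP => // ->.
by rewrite reduction0 syndrome0 !symd0 dec_loop0 symd0.
Qed.

Local Open Scope ring_scope.

(** Each level of decoding turns the bound for [j.+1] into the one for [j]. At level 1 a side has
    only two vertices and [reduction_pieces] does not apply, but by then no piece is left. *)
Lemma dec_loop_trivial j L (x : {set edge}) : (j < k)%N -> proper_pieces L ->
  cl x = chain k (2 ^ (k - j.+1))%N L -> (5 ^ j * phi L < 2 * 6 ^ j)%N ->
  cl (symd x (dec_loop j.+1 (syndrome x))) = 0.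
Proof.
elim: j L x => [|j IH] L x jk pL ex b.
  have L0 : L = [::].
    case: L b pL {ex} => // -[p q] L; rewrite /phi big_cons /=.
    rewrite /proper_pieces /= => b /andP[npq _].
    suff : (0 < dist1 p q)%N by lia.
    move: p q npq {b} => [p1 p2] [q1 q2]; rewrite xpair_eqE negb_and /dist1 /dist /=.
    by case/orP => /eqP; lia.
  have x0 : cl x = cl set0 by rewrite ex L0 /chain big_nil cl0.
  by rewrite (syndrome_cl k_gt0 x0) syndrome0 dec_loop0 symd0 x0 cl0.
have hc : (2 ^ (k - j.+2) * (2 * (2 * 2 ^ j)) = Defs.N k)%N.
  by rewrite -!expnS -expnD subnK.
have [L' [pL' eL' bL']] := reduction_pieces k_gt0 hc (erefl _) pL ex.
rewrite dec_loopS symdA -syndromeD.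
apply: (IH L') => //; first exact: ltnW.
  by rewrite eL' -expnS; congr (chain k (2 ^ _)%N); rewrite -subSn.
by move: b bL'; rewrite !expnS; nia.
Qed.

Lemma set_seq_symd (r : seq edge) : uniq r ->
  [set ed in r] = \big[@symd _/set0]_(ed <- r) [set ed].
Proof.
elim: r => [_|a r IH /= /andP[nar ur]].
  by rewrite big_nil; apply/setP => ed; rewrite !inE.
rewrite big_cons -IH //; apply/setP => ed; rewrite in_symd !inE.
by case: (ed =P a) => [->|_] //=; rewrite (negbTE nar).
Qed.

(** The far end is not reduced modulo [N], so an edge across the seam still has length 1. *)
Definition edge_piece (ed : edge) : piece :=
  ((ed.1.1 : nat, ed.1.2 : nat),
   if ed.2 then (ed.1.1 : nat, ed.1.2.+1) else (ed.1.1.+1, ed.1.2 : nat)).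

Lemma cl_edge_pieces (e : {set edge}) :
  cl e = chain k 1 [seq edge_piece ed | ed <- enum e].
Proof.
have {1}-> : e = [set ed in enum e] by apply/setP => ed; rewrite inE mem_enum.
rewrite set_seq_symd ?enum_uniq // cl_sum /chain big_map.
apply: eq_bigr => -[v []] _; rewrite -{1}(mkv_val v) /ptl !mul1n /=.
  exact: pot_vedge.
exact: pot_hedge.
Qed.

End Decoder.

(* omega_k >= (6/5)^(k-1) - 1, where omega_k is the largest w with decodes_upto k w:
   equivalently some w >= (6/5)^(k-1) - 1 satisfies decodes_upto k w. *)
Theorem theorem1 (k : nat) : (1 <= k)%N ->
  exists w : nat,
    (((6%:R / 5%:R : rat) ^+ k.-1 - 1 <= w%:R)%R) /\ decodes_upto k w.
Proof.
(* The largest [w] with [5 ^ j * w < 6 ^ j]; it satisfies [w + 1 >= (6 / 5) ^ j]. *)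
case: k => // j _; exists ((6 ^ j - 1) %/ 5 ^ j); split.
  rewrite lerBlDr natr1 expr_div_n ler_pdivrMr ?exprn_gt0 ?ltr0n //.
  rewrite -!natrX -natrM ler_nat.
  by have := ltn_ceil (6 ^ j - 1) (expn_gt0 5 j); rewrite subn1 prednK ?expn_gt0.
move=> e le_e; apply: cl_eq0; rewrite /decoder.
apply: (@dec_loop_trivial _ _ _ [seq edge_piece ed | ed <- enum e]) => //.
- by rewrite /proper_pieces all_map; apply/allP => -[v []] _; rewrite /= xpair_eqE; lia.
- by rewrite subnn expn0; apply: cl_edge_pieces.
have -> : phi [seq edge_piece ed | ed <- enum e] = 2 * #|e|.
  rewrite /phi big_map big_enum /= (eq_bigr (fun=> 2)) => [|[v []] _].
  - by rewrite sum_nat_const mulnC.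
  - by rewrite /dist1 /dist /=; lia.
  - by rewrite /dist1 /dist /=; lia.
have := leq_trunc_div (6 ^ j - 1) (5 ^ j).
have : 0 < 6 ^ j by rewrite expn_gt0.
have : 5 ^ j * #|e| <= (6 ^ j - 1) %/ 5 ^ j * 5 ^ j by rewrite mulnC leq_mul2r le_e orbT.
by move: ((6 ^ j - 1) %/ 5 ^ j * 5 ^ j) (5 ^ j) (6 ^ j) => a b d; lia.
Qed.
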